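(* Let $p$ be a zone tariff with single counting with an increasing price function $P:\mathbb{N}_{\ge 1}\to\mathbb{R}_{\ge 0}$ on a PTN $(V,E)$ with zone partition $\mathcal{Z}$ in which at most one zone is disconnected: there is $Z\in\mathcal{Z}$ decomposing into $k\ge 1$ connected components such that all zones in $\mathcal{Z}\setminus\{Z\}$ are connected. Consider the algorithm that, for two stations $x,y\in V$, builds the directed graph $G=(V,A)$ obtained by replacing each edge of the PTN by two arcs, one in each direction, with arc weights $\bar b(v,w)=\frac1k$ if $w\in Z$ and $v\notin Z$, and $\bar b(v,w)=b(v,w)$ otherwise, and returns a shortest $x$-$y$-path $W$ in $G$ with respect to $\bar b$. Then this algorithm yields a cheapest path from $x$ to $y$ and hence a cheapest standard ticket in polynomial time. In particular, if $P(m)\le P(i)+P(m-i+1)$ for all $m\in\mathbb{N}_{\ge 1}$ and $i\in\{1,\dots,m\}$, then the algorithm yields a cheapest ticket from $x$ to $y$, namely $(W)$.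
   Context: ''Increasing'' means non-decreasing. A PTN is a finite, simple, connected, undirected graph $(V,E)$. A path is a finite sequence $(x_1,\dots,x_n)$, $n\ge 1$, of (not necessarily distinct) nodes with consecutive nodes adjacent; $\mathcal{W}$ is the set of all paths. A zone partition $\mathcal{Z}$ is a partition of $V$ into nonempty sets called zones; a zone is connected if its induced subgraph is connected, and its components are those of the induced subgraph. The zone border weight is $b(v,w)=0$ if $v,w$ lie in the same zone and $1$ otherwise. For a path $W$, $\bar z(W)$ is the number of different zones containing at least one node of $W$. A fare structure $p:\mathcal{W}\to\mathbb{R}_{\ge 0}$ is a zone tariff with single counting with respect to $P$ if $p(W)=P(\bar z(W))$ for all $W\in\mathcal{W}$. A ticket of $W\in\mathcal{W}$ is a finite sequence of paths $T=(H_1,\dots,H_t)$ such that $W$ is a concatenation $W_1+\dots+W_t$ of subpaths with $W_j$ a subpath of $H_j$ for each $j$; its price is $\sum_{j=1}^t p(H_j)$. The standard ticket of $W$ is $(W)$. A cheapest ticket (resp. cheapest standard ticket) from $x$ to $y$ is one of minimum price among all tickets (resp. standard tickets) of all $x$-$y$-paths; a cheapest path from $x$ to $y$ is an $x$-$y$-path $W$ minimizing $p(W)$. *)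

(* Defs.v *)
From HB Require Import structures.
From mathcomp Require Import all_boot all_order all_algebra.
From mathcomp Require Import reals.

Set Implicit Arguments.
Unset Strict Implicit.
Unset Printing Implicit Defensive.

Import Order.TTheory GRing.Theory Num.Theory.
Local Open Scope ring_scope.

Section Network.
Variables (V : finType) (e : rel V).

Definition is_PTN : Prop :=
  [/\ symmetric e, irreflexive e & forall v w : V, connect e v w].

(* Nodes may repeat; the one-node sequence is a path, the empty one is not. *)
Definition is_path (W : seq V) : bool :=
  if W is v :: s then path e v s else false.

Definition is_path_from_to (x y : V) (W : seq V) : bool :=
  if W is v :: s then [&& v == x, path e v s & last v s == y] else false.

Definition induced (A : {set V}) : rel V := [rel v w in A | e v w].

Definition connected_zone (A : {set V}) : Prop :=
  {in A &, forall v w : V, connect (induced A) v w}.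

(* Since [e] is symmetric, its pairs are exactly the arcs of the digraph in
   which each edge is replaced by two opposite arcs; directed paths of that
   digraph are therefore the sequences satisfying [is_path_from_to]. *)
Definition path_weight (wt : V -> V -> rat) (W : seq V) : rat :=
  \sum_(a <- zip W (behead W)) wt a.1 a.2.

Definition shortest_path (wt : V -> V -> rat) (x y : V) (W : seq V) : Prop :=
  is_path_from_to x y W /\
  (forall W' : seq V, is_path_from_to x y W' ->
     path_weight wt W <= path_weight wt W').

(* Consecutive paths share a node:
   (x_1,...,x_i) + (x_i,...,x_n) = (x_1,...,x_n). *)
Inductive concatenation : seq (seq V) -> seq V -> Prop :=
| Concat1 (W : seq V) : concatenation [:: W] W
| ConcatS (v : V) (s t : seq V) (Ws : seq (seq V)) :
    concatenation Ws (last v s :: t) ->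
    concatenation ((v :: s) :: Ws) (v :: s ++ t).

Definition is_ticket (W : seq V) (T : seq (seq V)) : Prop :=
  all is_path T /\
  exists Ws : seq (seq V),
    [/\ all is_path Ws, concatenation Ws W & all2 (@infix V) Ws T].

Definition standard_ticket (W : seq V) : seq (seq V) := [:: W].

Section Zones.
Variable ZZ : {set {set V}}.

Definition one_disconnected_zone (Z : {set V}) (k : nat) : Prop :=
  [/\ Z \in ZZ, (1 <= k)%N, n_comp (induced Z) Z = k
    & forall Z' : {set V}, Z' \in ZZ -> Z' != Z -> connected_zone Z'].

Definition border_weight (v w : V) : rat :=
  if pblock ZZ v == pblock ZZ w then 0 else 1.

Definition modified_weight (Z : {set V}) (k : nat) (v w : V) : rat :=
  if (w \in Z) && (v \notin Z) then k%:R^-1 else border_weight v w.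

Definition zones_visited (W : seq V) : nat :=
  #|[set A in ZZ | [exists v in A, v \in W]]|.

End Zones.

Section Fares.
Variables (R : realType) (p : seq V -> R).

(* Only the values of [p] on paths are relevant. *)
Definition single_counting_tariff (ZZ : {set {set V}}) (P : nat -> R) : Prop :=
  forall W : seq V, is_path W -> p W = P (zones_visited ZZ W).

Definition cheapest_path (x y : V) (W : seq V) : Prop :=
  is_path_from_to x y W /\
  (forall W' : seq V, is_path_from_to x y W' -> p W <= p W').

Definition ticket_price (T : seq (seq V)) : R := \sum_(H <- T) p H.

Definition cheapest_standard_ticket (x y : V) (T : seq (seq V)) : Prop :=
  (exists2 W : seq V, is_path_from_to x y W & T = standard_ticket W) /\
  (forall W' : seq V, is_path_from_to x y W' ->
     ticket_price T <= ticket_price (standard_ticket W')).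

Definition cheapest_ticket (x y : V) (T : seq (seq V)) : Prop :=
  (exists2 W : seq V, is_path_from_to x y W & is_ticket W T) /\
  (forall (W' : seq V) (T' : seq (seq V)),
     is_path_from_to x y W' -> is_ticket W' T' ->
     ticket_price T <= ticket_price T').

End Fares.
End Network.

Section PriceFunctions.
Variables (R : realType) (P : nat -> R).

(* Price functions have domain {1, 2, ...}: the value [P 0] is irrelevant. *)
Definition nonnegative_price : Prop := forall m : nat, (1 <= m)%N -> 0 <= P m.

Definition increasing_price : Prop :=
  forall m n : nat, (1 <= m)%N -> (m <= n)%N -> P m <= P n.

Definition no_benefit_from_splitting : Prop :=
  forall m i : nat, (1 <= m)%N -> (1 <= i <= m)%N ->
    P m <= P i + P (m - i + 1)%N.

End PriceFunctions.

(* Model of computation: structured programs for a random access machine whose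
   cells hold natural numbers. The only arithmetic is addition and truncated
   subtraction, each at unit cost; as there is no multiplication, the bit
   length of the numbers grows by at most one per step, so that polynomial time
   here agrees with polynomial time on Turing machines. *)
Inductive expr : Type :=
| Const of nat
| Cell of expr
| Plus of expr & expr
| Minus of expr & expr.

Inductive program : Type :=
| Store of expr & expr
| Seq of program & program
| If of expr & program & program
| While of expr & program.

Definition memory : Type := nat -> nat.

Definition update (m : memory) (a v : nat) : memory :=
  fun a' => if a' == a then v else m a'.

Fixpoint eval (m : memory) (E : expr) : nat :=
  match E with
  | Const c => c
  | Cell E1 => m (eval m E1)
  | Plus E1 E2 => eval m E1 + eval m E2
  | Minus E1 E2 => eval m E1 - eval m E2
  end%N.

Fixpoint cost (E : expr) : nat :=
  match E with
  | Const _ => 1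
  | Cell E1 => (cost E1).+1
  | Plus E1 E2 | Minus E1 E2 => (cost E1 + cost E2).+1
  end%N.

(* [exec q m t m']: started on [m], the program [q] halts after [t] steps with
   memory [m']. [Store E1 E2] writes the value of [E2] at address [E1]; in tests
   any nonzero value counts as true. *)
Inductive exec : program -> memory -> nat -> memory -> Prop :=
| ExecStore (E1 E2 : expr) (m : memory) :
    exec (Store E1 E2) m (cost E1 + cost E2).+1
         (update m (eval m E1) (eval m E2))
| ExecSeq (q1 q2 : program) (m1 m2 m3 : memory) (t1 t2 : nat) :
    exec q1 m1 t1 m2 -> exec q2 m2 t2 m3 -> exec (Seq q1 q2) m1 (t1 + t2)%N m3
| ExecIfTrue (E : expr) (q1 q2 : program) (m m' : memory) (t : nat) :
    eval m E <> 0%N -> exec q1 m t m' ->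
    exec (If E q1 q2) m (cost E + t).+1 m'
| ExecIfFalse (E : expr) (q1 q2 : program) (m m' : memory) (t : nat) :
    eval m E = 0%N -> exec q2 m t m' ->
    exec (If E q1 q2) m (cost E + t).+1 m'
| ExecWhileTrue (E : expr) (q : program) (m1 m2 m3 : memory) (t1 t2 : nat) :
    eval m1 E <> 0%N -> exec q m1 t1 m2 -> exec (While E q) m2 t2 m3 ->
    exec (While E q) m1 (cost E + t1 + t2).+1 m3
| ExecWhileFalse (E : expr) (q : program) (m : memory) :
    eval m E = 0%N -> exec (While E q) m (cost E).+1 m.

Section Encoding.
Variable V : finType.

Definition station_code (v : V) : nat := enum_rank v.

(* Number of stations, the two stations, the zone number of each station, and
   the adjacency matrix row by row. Neither the possibly disconnected zone nor
   its number of components is part of the input. *)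
Definition input_code (e : rel V) (ZZ : {set {set V}}) (x y : V) : seq nat :=
  [:: #|V|; station_code x; station_code y]
  ++ [seq index (pblock ZZ v) (enum ZZ) | v <- enum V]
  ++ [seq (e v w : nat) | v <- enum V, w <- enum V].

Definition initial_memory (s : seq nat) : memory := nth 0%N s.

(* The length of the output is in cell 0, its entries in cells 1, 2, ... *)
Definition output (m : memory) : seq nat := [seq m i | i <- iota 1 (m 0%N)].

End Encoding.

(* Main.v *)
Require Import Defs.
From HB Require Import structures.
From mathcomp Require Import all_boot all_order all_algebra.
From mathcomp Require Import reals zify.

Set Implicit Arguments.
Unset Strict Implicit.
Unset Printing Implicit Defensive.

Import Order.TTheory GRing.Theory Num.Theory.

(** Why shortest walks are cheapest. Multiply the modified weight by [k]: entering
    the zone [Z] then costs 1 and entering any other zone costs [k]. A walk has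
    to enter each of its zones except the first at least once, which bounds its
    cost from below ([walk_cost_ge]). Conversely, moving inside a component of a
    zone is free, so a walk can be shortened in the graph of components until it
    enters each component at most once. Since [Z] has only [k] components and the
    other zones have one, the shortened walk costs at most [k] per zone different
    from [Z] and from the first one, plus what [k] entries to [Z] cost, that is
    [k], or [k - 1] if the walk starts in [Z] ([economical_walk]). Comparing both
    bounds shows that no walk between the same stations visits fewer zones than a
    shortest one ([shortest_min_zones]). Under the splitting condition, the
    pieces of a ticket can be merged one by one without raising the price, because
    consecutive pieces share the zone of their common node ([ticket_price_ge]).

    Why a shortest walk can be found in polynomial time. Neither [Z] nor [k] is
    given, but both can be computed: propagating least station numbers along arcs
    inside zones identifies the components ([label_components_correct]), and
    counting one representative for each component of a zone gives [k] and [Z]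
    ([count_components_correct]). Distances to the destination are then computed
    by Bellman-Ford relaxation for the weight [hop], the scaled weight times the
    number of stations plus 1 ([distance_correct]). The additional unit makes all
    arcs positive without reversing the order of simple walks
    ([min_hop_min_weight]), so going to any neighbour that accounts for the
    current distance leads from the start to the destination without repetition
    ([trace_walk_correct]).

    The machine program is not written directly. A small language of arrays named
    by registers is compiled to it ([compile_correct]), with weakest preconditions
    that bound the number of iterations of every loop by a common bound [B]. For a
    fixed program, running time is polynomial in [B] for syntactic reasons
    ([wp_sound], [time_bound_poly]), and [B] can be taken proportional to the
    fourth power of the number of stations. *)

(** * Walks and their integer costs *)

Section Walks.
Variable V : finType.
Implicit Types (x y : V) (s : seq V) (c : V -> V -> nat).

Fixpoint walk_cost c x s : nat :=
  if s is y :: s' then c x y + walk_cost c y s' else 0.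

Lemma walk_cost_cat c x s1 s2 :
  walk_cost c x (s1 ++ s2) = walk_cost c x s1 + walk_cost c (last x s1) s2.
Proof. by elim: s1 x => //= y s1 IH x; rewrite IH addnA. Qed.

Lemma is_path_from_toP e x y W :
  reflect (exists s, [/\ W = x :: s, path e x s & last x s = y])
          (is_path_from_to e x y W).
Proof.
apply: (iffP idP) => [|[s [-> /= -> ->]]]; last by rewrite !eqxx.
by case: W => // v s /and3P[/eqP-> p_s /eqP<-]; exists s.
Qed.

(** Removing a closed detour never makes a walk dearer, so every walk can be
    replaced by a simple one. *)
Lemma simple_walk (e : rel V) c x s : path e x s ->
  exists s', [/\ path e x s', last x s' = last x s, uniq (x :: s')
               & walk_cost c x s' <= walk_cost c x s].
Proof.
elim: s x => [|y s IH] x /=; first by exists [::].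
case/andP=> exy /IH[s' [p_s' <- u_s' le_s']].
have [/splitPl xs|xs] := boolP (x \in y :: s'); last first.
  by exists (y :: s'); split=> //=; [rewrite exy | rewrite xs | lia].
case: xs p_s' u_s' le_s' => s1 s2 xE.
rewrite cat_path walk_cost_cat -cat_cons cat_uniq xE => /andP[_ p_s2].
case/and3P=> _ /hasPn x_s2 u_s2 le_s'.
exists s2; split=> //; first by rewrite last_cat xE.
  rewrite /= u_s2 andbT; apply: contraL (mem_last y s1) => /x_s2 /=.
  by rewrite xE.
by lia.
Qed.

End Walks.

(** * The scaled weight and the number of zones *)

Section ZoneCosts.
Variables (V : finType) (e : rel V) (ZZ : {set {set V}}) (Z : {set V}) (k : nat).
Hypotheses (e_sym : symmetric e) (ZZ_part : partition ZZ [set: V]).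
Implicit Types (v w x y : V) (s : seq V) (W : seq V) (A B : {set V}).

Definition zone v := pblock ZZ v.

Lemma cover_setT v : v \in cover ZZ.
Proof. by rewrite (cover_partition ZZ_part) inE. Qed.

Lemma zone_mem v : zone v \in ZZ.
Proof. by rewrite pblock_mem ?cover_setT. Qed.

Lemma mem_zone v : v \in zone v.
Proof. by rewrite mem_pblock cover_setT. Qed.

Lemma zoneP A v : A \in ZZ -> (v \in A) = (zone v == A).
Proof.
move=> A_ZZ; apply/idP/eqP => [vA|<-]; last exact: mem_zone.
by apply: def_pblock => //; case/and3P: ZZ_part.
Qed.

Definition zones_of W : {set {set V}} := [set zone v | v in W].

Lemma zones_visitedE W : zones_visited ZZ W = #|zones_of W|.
Proof.
rewrite /zones_visited; apply: eq_card => A; rewrite inE.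
apply/andP/imsetP => [[A_ZZ /existsP[v /andP[vA vW]]]|[v vW ->]].
  by exists v => //; apply/eqP; rewrite eq_sym -zoneP.
by split; [exact: zone_mem | apply/existsP; exists v; rewrite mem_zone].
Qed.

Lemma zones_of_cons v W : zones_of (v :: W) = zone v |: zones_of W.
Proof.
apply/setP=> A; rewrite in_setU1; apply/imsetP/orP.
  case=> w; rewrite inE => /orP[/eqP->|wW] ->; first by left.
  by right; apply: imset_f.
by case=> [/eqP->|/imsetP[w wW ->]]; [exists v | exists w]; rewrite ?inE ?eqxx ?wW ?orbT.
Qed.

Lemma zones_of_mono W W' : {subset W <= W'} -> zones_of W \subset zones_of W'.
Proof. by move=> sub; apply: imsetS; apply/subsetP. Qed.

Lemma zones_of_cat W W' : zones_of (W ++ W') = zones_of W :|: zones_of W'.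
Proof.
elim: W => [|v W IH]; last by rewrite cat_cons !zones_of_cons IH setUA.
have -> : zones_of [::] = set0.
  by apply/setP=> A; rewrite inE; apply/negbTE/imsetP=> -[].
by rewrite set0U.
Qed.

Definition scaled_weight v w : nat :=
  if (w \in Z) && (v \notin Z) then 1
  else if zone v == zone w then 0 else k.

Definition entry_cost A : nat := if A == Z then 1 else k.

Hypothesis Z_ZZ : Z \in ZZ.

Lemma scaled_weightE v w : 0 < k ->
  modified_weight ZZ Z k v w = ((scaled_weight v w)%:R / k%:R)%R.
Proof.
move=> k0; rewrite /modified_weight /scaled_weight /border_weight -/(zone v) -/(zone w).
case: ifP => _; first by rewrite div1r.
by case: ifP => _; rewrite ?mul0r // divff // pnatr_eq0 -lt0n.
Qed.

Lemma path_weightE x s : 0 < k ->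
  path_weight (modified_weight ZZ Z k) (x :: s)
  = ((walk_cost scaled_weight x s)%:R / k%:R)%R.
Proof.
move=> k0; rewrite /path_weight /=.
elim: s x => [|y s IH] x /=; first by rewrite big_nil mul0r.
by rewrite big_cons IH scaled_weightE //= natrD mulrDl.
Qed.

Lemma shortest_pathP x y W : 0 < k ->
  shortest_path e (modified_weight ZZ Z k) x y W <->
  exists s, [/\ W = x :: s, path e x s, last x s = y
    & forall s', path e x s' -> last x s' = y ->
      walk_cost scaled_weight x s <= walk_cost scaled_weight x s'].
Proof.
move=> k0.
have le_weight s s' :
  (path_weight (modified_weight ZZ Z k) (x :: s)
     <= path_weight (modified_weight ZZ Z k) (x :: s'))%R
  = (walk_cost scaled_weight x s <= walk_cost scaled_weight x s').
  by rewrite !path_weightE // ler_pM2r ?invr_gt0 ?ltr0n // ler_nat.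
split=> [[/is_path_from_toP[s [-> p_s l_s]] min_s]|[s [-> p_s l_s min_s]]].
  exists s; split=> // s' p_s' l_s'; rewrite -le_weight; apply: min_s.
  by apply/is_path_from_toP; exists s'.
split; first by apply/is_path_from_toP; exists s.
by move=> _ /is_path_from_toP[s' [-> p_s' l_s']]; rewrite le_weight min_s.
Qed.

(** Induction on the walk: putting an arc in front of it adds at most the zone of
    the second node to the zones to be entered, and then the arc enters it. *)
Lemma walk_cost_ge x s :
  \sum_(A in zones_of (x :: s) :\ zone x) entry_cost A
  <= walk_cost scaled_weight x s.
Proof.
have sum_sub (S S' : {set {set V}}) : S \subset S' ->
    \sum_(A in S) entry_cost A <= \sum_(A in S') entry_cost A.
  move=> sub; rewrite [leqRHS](big_setID S) /= (setIidPr sub); exact: leq_addr.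
elim: s x => [|y s IH] x /=.
  rewrite big1 // => A; rewrite zones_of_cons !inE => /andP[/negPf->] /=.
  by case/imsetP.
rewrite zones_of_cons; case: (eqVneq (zone x) (zone y)) => [eq_xy|neq_xy].
  apply: leq_trans (leq_trans (IH y) (leq_addl _ _)).
  apply: sum_sub; rewrite eq_xy; apply/subsetP=> A.
  by rewrite !inE; case: (A == zone y).
apply: leq_trans (leq_add (leqnn _) (IH y)).
have -> : scaled_weight x y = entry_cost (zone y).
  rewrite /scaled_weight /entry_cost !zoneP // (negPf neq_xy).
  by case: (eqVneq (zone y) Z) => [<-|//]; rewrite neq_xy.
rewrite -big_setU1 /= ?setD11 //.
apply: sum_sub; apply/subsetP=> A; rewrite !inE.
by case: (A == zone y) => //=; case: (A == zone x).
Qed.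

(** * Components of zones *)

(** Components are represented by nodes, so that [n_comp] counts the fixed points
    of this function and two nodes can be compared by their images. *)
Definition component v : V := fingraph.root (induced e (zone v)) v.

Lemma induced_sym A : connect_sym (induced e A).
Proof. by apply: sym_connect_sym => v w; rewrite /induced /= e_sym [(v \in A) && _]andbC. Qed.

Lemma connect_induced_mem A v w : connect (induced e A) v w -> v \in A -> w \in A.
Proof.
move=> vw; have -> // : (v \in A) = (w \in A).
by apply: (closed_connect _ vw) => ? ? /= /andP[/andP[-> ->]].
Qed.

Lemma zone_comp v : zone (component v) = zone v.
Proof.
apply/eqP; rewrite -zoneP ?zone_mem //.
exact: connect_induced_mem (connect_root _ _) (mem_zone v).
Qed.

Lemma comp_idem v : component (component v) = component v.
Proof. by rewrite {1}/component zone_comp root_root //; apply: induced_sym. Qed.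

Lemma comp_eq_connect v w : component v = component w -> connect (induced e (zone v)) v w.
Proof.
move=> eq_vw; have zE : zone w = zone v by rewrite -(zone_comp w) -eq_vw zone_comp.
apply/(fingraph.rootP (induced_sym _)).
by move: eq_vw; rewrite /component zE.
Qed.

Lemma connect_comp v w : connect (induced e (zone v)) v w -> component v = component w.
Proof.
move=> vw; have : w \in zone v by apply: connect_induced_mem vw (mem_zone _).
rewrite zoneP ?zone_mem // => /eqP zE; rewrite /component zE.
by apply/(fingraph.rootP (induced_sym _)).
Qed.

Lemma induced_path_free x s : path (induced e (zone x)) x s ->
  path e x s /\ walk_cost scaled_weight x s = 0.
Proof.
elim: s x => [|y s IH] x //= /andP[/andP[/andP[_ yx] exy]].
have zE : zone y = zone x by apply/eqP; rewrite -zoneP ?zone_mem.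
rewrite -zE => /IH[-> ->]; rewrite exy; split=> //.
rewrite /scaled_weight zE eqxx !zoneP // zE.
by case: (_ == Z).
Qed.

Lemma scaled_weight_comp v w : scaled_weight (component v) (component w) = scaled_weight v w.
Proof. by rewrite /scaled_weight !zoneP // !zone_comp. Qed.

Definition comp_arc : rel V :=
  [rel b b' | [exists v, exists w, [&& e v w, component v == b & component w == b']]].

(** Moving inside a component is free, and the scaled weight of an arc depends
    only on the components of its end nodes. *)
Lemma lift_comp_walk p x y :
  path comp_arc (component x) p -> last (component x) p = component y ->
  exists s, [/\ path e x s, last x s = y
    & walk_cost scaled_weight x s = walk_cost scaled_weight (component x) p].
Proof.
elim: p x => [|b p IH] x /=.
  move=> _ /comp_eq_connect/connectP[s p_s ->].
  by have [p_e c0] := induced_path_free p_s; exists s.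
case/andP=> /existsP[v /existsP[w /and3P[evw /eqP vx /eqP <-]]] p_p l_p.
have [s2 [p2 l2 c2]] := IH w p_p l_p.
have /connectP[s1 /induced_path_free[p1 c1] l1] := comp_eq_connect (esym vx).
exists (s1 ++ w :: s2); split.
- by rewrite cat_path p1 -l1 /= evw.
- by rewrite last_cat.
- by rewrite walk_cost_cat c1 -l1 /= c2 -vx scaled_weight_comp.
Qed.

Lemma scaled_weight_le v w : scaled_weight v w <= entry_cost (zone w).
Proof.
rewrite /scaled_weight /entry_cost !zoneP //.
by case: (eqVneq (zone w) Z) => [->|_] /=; case: (zone v == _).
Qed.

Hypothesis k_comp : n_comp (induced e Z) Z = k.
Hypothesis other_conn : forall A, A \in ZZ -> A != Z -> connected_zone e A.

Lemma comp_connected v w : zone v != Z -> zone v = zone w -> component v = component w.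
Proof.
move=> vZ vw; apply: connect_comp; apply: other_conn => //; first exact: zone_mem.
  exact: mem_zone.
by rewrite vw mem_zone.
Qed.

Lemma n_comp_zone A : A \in ZZ ->
  n_comp (induced e A) A = #|[set v in A | component v == v]|.
Proof.
move=> A_ZZ; apply: eq_card => v; rewrite inE.
have rE : v \in A -> roots (induced e A) v = (component v == v).
  by rewrite zoneP // /component => /eqP->.
by apply/andP/andP => -[/= r_v vA]; [rewrite -rE | rewrite rE].
Qed.

(** The cost of entering every component of [Z] once, except the one in which the
    walk starts, if [Z] is visited at all. *)
Definition disconnected_allowance x W :=
  if zone x == Z then k.-1 else if Z \in zones_of W then k else 0.

Lemma sum_entry_cost (S : {set {set V}}) : Z \notin S ->
  \sum_(A in S) entry_cost A = k * #|S|.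
Proof.
move=> ZS; rewrite mulnC -sum_nat_const; apply: eq_bigr => A AS.
by rewrite /entry_cost; case: eqP => // AZ; rewrite -AZ AS in ZS.
Qed.

(** Project the walk to the graph of components, remove its loops there and lift
    the result. It enters a connected zone at most once and [Z] at most once per
    component, not counting the component in which it starts. *)
Lemma economical_walk x s : path e x s ->
  exists s', [/\ path e x s', last x s' = last x s
    & walk_cost scaled_weight x s' <=
      k * #|zones_of (x :: s) :\ zone x :\ Z| + disconnected_allowance x (x :: s)].
Proof.
move=> p_s.
have p_comp : path comp_arc (component x) (map component s).
  elim: s x p_s => //= y s IH x /andP[exy /IH->]; rewrite andbT.
  by apply/existsP; exists x; apply/existsP; exists y; rewrite exy !eqxx.
move El: (last (component x) (map component s)) => y'.
have : y' = component (last x s) by rewrite -El last_map.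
rewrite -El; case/shortenP: p_comp => p p_p u_p sub_p l_p.
have [s' [p_s' l_s' cost_s']] := lift_comp_walk p_p l_p.
exists s'; split=> //; rewrite {}cost_s'.
have root_p b : b \in component x :: p -> component b = b.
  rewrite inE => /predU1P[->|/sub_p/mapP[v _ ->]]; exact: comp_idem.
have zone_p b : b \in p -> zone b \in zones_of (x :: s).
  move/sub_p/mapP=> [v vs ->]; rewrite zone_comp.
  by apply: imset_f; rewrite inE vs orbT.
have : walk_cost scaled_weight (component x) p <= \sum_(b <- p) entry_cost (zone b).
  elim: (p) (component x) => [|b p' IH] a /=; first by rewrite big_nil.
  by rewrite big_cons leq_add ?scaled_weight_le.
move/leq_trans; apply.
rewrite (bigID (fun b => zone b == Z)) /= addnC leq_add //.
  rewrite -big_filter (eq_big_seq (fun=> k)); last first.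
    by move=> b; rewrite mem_filter /entry_cost => /andP[/negPf->].
  rewrite big_const_seq count_predT iter_addn_0 leq_mul2l; apply/orP; right.
  rewrite -(size_map zone) cardE; apply: uniq_leq_size.
    rewrite map_inj_in_uniq ?filter_uniq //; first by case/andP: u_p.
    move=> b b'; rewrite !mem_filter => /andP[bZ bp] /andP[_ bp'] eqz.
    rewrite -(root_p b) ?inE ?bp ?orbT // -(root_p b') ?inE ?bp' ?orbT //.
    exact: comp_connected.
  move=> A /mapP[b]; rewrite mem_filter => /andP[bZ bp] ->.
  rewrite mem_enum inE in_set1 bZ inE in_set1 zone_p // andbT /=.
  apply/eqP=> bx; case/andP: u_p => /negP[].
  by rewrite -(comp_connected bZ bx) root_p // inE bp orbT.
rewrite -big_filter (eq_big_seq (fun=> 1)); last first.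
  by move=> b; rewrite mem_filter /entry_cost => /andP[->].
rewrite sum1_size /disconnected_allowance; set pZ := filter _ p.
have pZ_mem b : b \in pZ -> b \in enum [set v in Z | component v == v].
  rewrite mem_filter mem_enum inE => /andP[bZ bp].
  by rewrite zoneP // bZ root_p ?eqxx // inE bp orbT.
have kE : k = size (enum [set v in Z | component v == v]) by rewrite -cardE -n_comp_zone.
have u_pZ : uniq pZ by rewrite filter_uniq //; case/andP: u_p.
case: ifP => [xZ|_].
  have : size (component x :: pZ) <= k; last by move=> /=; lia.
  rewrite kE; apply: uniq_leq_size => /=.
    rewrite u_pZ andbT mem_filter; case/andP: u_p => /negPf-> _.
    by rewrite andbF.
  move=> b; rewrite inE => /predU1P[->|/pZ_mem //].
  by rewrite mem_enum inE comp_idem eqxx zoneP // zone_comp xZ.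
case: ifP => [_|ZW]; first by rewrite {1}kE; apply: uniq_leq_size.
rewrite leqn0 size_eq0 -[_ == _]negbK -has_filter; apply/hasPn => b bp.
by apply/eqP=> bZ; move: (zone_p b bp); rewrite bZ ZW.
Qed.

(** If the walks start in [Z], the allowance is less than the cost [k] of one
    further zone. Otherwise it is [k] exactly when the competitor visits [Z], and
    then [Z] itself counts as one more zone of the competitor. *)
Lemma shortest_min_zones x s s' :
  0 < k -> path e x s -> path e x s' -> last x s' = last x s ->
  (forall s'', path e x s'' -> last x s'' = last x s ->
     walk_cost scaled_weight x s <= walk_cost scaled_weight x s'') ->
  zones_visited ZZ (x :: s) <= zones_visited ZZ (x :: s').
Proof.
move=> k0 p_s p_s' l_s' min_s; rewrite !zones_visitedE.
have [s'' [p_s'' l_s'' le_s'']] := economical_walk p_s'.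
have := leq_trans (leq_trans (walk_cost_ge x s) (min_s _ p_s'' (etrans l_s'' l_s'))) le_s''.
have card_zones W : zone x \in zones_of W ->
  #|zones_of W| = (Z \in zones_of W :\ zone x) + #|zones_of W :\ zone x :\ Z| + 1.
  by move=> xW; rewrite (cardsD1 (zone x)) xW (cardsD1 Z (_ :\ zone x)) addnC.
rewrite !card_zones ?zones_of_cons ?setU11 // -!zones_of_cons.
set S := zones_of (x :: s); set S' := zones_of (x :: s').
have -> : \sum_(A in S :\ zone x) entry_cost A
          = (Z \in S :\ zone x) + k * #|S :\ zone x :\ Z|.
  have [ZS|ZS] := boolP (Z \in S :\ zone x).
    rewrite (big_setD1 Z) //= {1}/entry_cost eqxx sum_entry_cost //.
    by rewrite !inE eqxx.
  rewrite sum_entry_cost // (_ : S :\ zone x :\ Z = S :\ zone x) //.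
  by apply/setDidPl; rewrite disjoint_sym disjoints1.
rewrite /disconnected_allowance -/S'.
have -> : (Z \in S :\ zone x) = (zone x != Z) && (Z \in S) by rewrite !inE eq_sym.
have -> : (Z \in S' :\ zone x) = (zone x != Z) && (Z \in S') by rewrite !inE eq_sym.
set a := #|S :\ zone x :\ Z|; set a' := #|S' :\ zone x :\ Z|.
have cancel_k i j : k * i + 1 <= k * j -> i < j.
  by move=> le_ij; rewrite -(ltn_pmul2l k0); lia.
case: (zone x == Z) => /=.
  move=> le_aa'; suff : a < a'.+1 by lia.
  by apply: cancel_k; rewrite mulnS; lia.
case: (Z \in S); case: (Z \in S') => /= le_aa'.
- suff : a < a'.+1 by lia.
  by apply: cancel_k; rewrite mulnS; lia.
- suff : a < a' by lia.
  by apply: cancel_k; lia.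
- suff : a <= a'.+1 by lia.
  by rewrite -(leq_pmul2l k0) mulnS; lia.
- suff : a <= a' by lia.
  by rewrite -(leq_pmul2l k0); lia.
Qed.

End ZoneCosts.

(** * Tickets *)

Section Tickets.
Variables (V : finType) (e : rel V) (ZZ : {set {set V}}).
Hypothesis ZZ_part : partition ZZ [set: V].
Variables (R : realType) (P : nat -> R) (p : seq V -> R).
Hypotheses (P_incr : increasing_price P) (p_zones : single_counting_tariff e p ZZ P).
Hypothesis P_split : no_benefit_from_splitting P.
Local Open Scope ring_scope.

Lemma zones_visited_gt0 v s : (0 < zones_visited ZZ (v :: s))%N.
Proof.
rewrite zones_visitedE // card_gt0; apply/set0Pn; exists (zone ZZ v).
by rewrite zones_of_cons setU11.
Qed.

Lemma zones_visited_mono (W W' : seq V) : {subset W <= W'} ->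
  (zones_visited ZZ W <= zones_visited ZZ W')%N.
Proof. by move=> sub; rewrite !zones_visitedE //; apply/subset_leq_card/zones_of_mono. Qed.

(** The two parts share the zone of the node where they meet. *)
Lemma zones_visited_concat v s t :
  (zones_visited ZZ (v :: s ++ t) <
   zones_visited ZZ (v :: s) + zones_visited ZZ (last v s :: t))%N.
Proof.
rewrite !zones_visitedE // -cat_cons zones_of_cat.
have -> : zones_of ZZ (v :: s) :|: zones_of ZZ t
        = zones_of ZZ (v :: s) :|: zones_of ZZ (last v s :: t).
  have /setUidPl lastE : [set zone ZZ (last v s)] \subset zones_of ZZ (v :: s).
    by rewrite sub1set; apply: imset_f (mem_last v s).
  by rewrite (zones_of_cons ZZ (last v s)) setUA lastE.
rewrite cardsU; set I := _ :&: _.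
have : (0 < #|I|)%N.
  rewrite card_gt0; apply/set0Pn; exists (zone ZZ (last v s)).
  rewrite inE; apply/andP; split; apply: imset_f; first exact: mem_last.
  exact: mem_head.
have : (#|I| <= #|zones_of ZZ (v :: s)|)%N by rewrite subset_leq_card ?subsetIl.
lia.
Qed.

(** With [m], [i] and [j] zones in the whole walk, its first piece and the rest,
    [m - i + 1 <= j], so that the splitting condition applies. *)
Lemma ticket_price_ge W T : is_ticket e W T ->
  P (zones_visited ZZ W) <= ticket_price p T.
Proof.
move=> [path_T [Ws [path_Ws cat_Ws sub_Ws]]].
elim: cat_Ws T path_T path_Ws sub_Ws => [{}W|v s t {}Ws _ IH] [|H T] //=.
  case/andP=> path_H path_T; rewrite andbT => path_W /andP[/mem_infix sub_H].
  case: T path_T => // _ _; rewrite /ticket_price big_seq1 p_zones //.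
  by apply: P_incr; [case: W path_W {sub_H} => // ? ? _; apply: zones_visited_gt0
    | apply: zones_visited_mono].
case/andP=> path_H path_T /andP[path_vs path_Ws] /andP[/mem_infix sub_H sub_Ws].
have := IH T path_T path_Ws sub_Ws.
rewrite /ticket_price big_cons p_zones // => price_T.
have := zones_visited_concat v s t; set m := zones_visited _ (v :: s ++ t).
set i := zones_visited _ (v :: s); set j := zones_visited _ (last v s :: t) => m_ij.
have i_gt0 : (0 < i)%N by apply: zones_visited_gt0.
have i_m : (i <= m)%N.
  by apply: zones_visited_mono => u; rewrite -cat_cons mem_cat => ->.
apply: (le_trans (y := P i + P (m - i + 1)%N)); first by apply: P_split; lia.
apply: lerD; first by apply: P_incr => //; apply: zones_visited_mono.
by apply: le_trans price_T; apply: P_incr; lia.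
Qed.

End Tickets.

Section CheapestPaths.
Variables (V : finType) (e : rel V) (ZZ : {set {set V}}) (Z : {set V}) (k : nat).
Hypotheses (e_sym : symmetric e) (ZZ_part : partition ZZ [set: V]).
Hypothesis Z_disc : one_disconnected_zone e ZZ Z k.
Local Open Scope ring_scope.

Lemma shortest_path_cheapest (R : realType) (P : nat -> R) (p : seq V -> R) x y W :
  increasing_price P -> single_counting_tariff e p ZZ P ->
  shortest_path e (modified_weight ZZ Z k) x y W ->
  [/\ cheapest_path e p x y W,
      cheapest_standard_ticket e p x y (standard_ticket W)
    & no_benefit_from_splitting P ->
      cheapest_ticket e p x y (standard_ticket W)].
Proof.
move=> P_incr p_zones; have [Z_ZZ k0 k_comp other] := Z_disc.
case/(shortest_pathP e _ _ x y W k0) => s [-> p_s l_s min_s].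
have xyW : is_path_from_to e x y (x :: s) by apply/is_path_from_toP; exists s.
have P_min W' : is_path_from_to e x y W' ->
    P (zones_visited ZZ (x :: s)) <= P (zones_visited ZZ W').
  case/is_path_from_toP=> s' [-> p_s' l_s']; apply: P_incr; first exact: zones_visited_gt0.
  apply: (shortest_min_zones e_sym _ Z_ZZ k_comp) => //; last by rewrite l_s.
  by rewrite l_s' l_s.
have xy_path W' : is_path_from_to e x y W' -> is_path e W'.
  by case/is_path_from_toP=> s' [-> ].
split.
- by split=> // W' xyW'; rewrite !p_zones ?(xy_path _ xyW') ?P_min.
- split=> [|W' xyW']; first by exists (x :: s).
  by rewrite /ticket_price !big_seq1 !p_zones ?(xy_path _ xyW') ?P_min.
move=> P_split; split=> [|W' T' xyW' tick].
  exists (x :: s) => //; split; first by rewrite /= p_s.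
  exists [:: x :: s]; split=> /=; first by rewrite p_s.
    exact: Concat1.
  by rewrite eqxx prefix_refl.
rewrite /standard_ticket {1}/ticket_price big_seq1 p_zones ?(xy_path _ xyW) //.
apply: le_trans (P_min _ xyW') _.
by apply: ticket_price_ge tick.
Qed.

End CheapestPaths.

(** * Total correctness and running time of machine programs *)

(** Weakest precondition of [q] when every execution of every loop is required to
    stop within [B] iterations. Running time is then a matter of syntax alone
    ([time_bound]), and correctness proofs need not mention it. *)
Fixpoint wp (B : nat) (q : program) (Q : memory -> Prop) : memory -> Prop :=
  match q with
  | Store E1 E2 => fun m => Q (update m (eval m E1) (eval m E2))
  | Seq q1 q2 => wp B q1 (wp B q2 Q)
  | If E q1 q2 => fun m => if eval m E != 0 then wp B q1 Q m else wp B q2 Q m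
  | While E q1 =>
      iter B (fun R m => if eval m E != 0 then wp B q1 R m else Q m)
             (fun m => eval m E = 0 /\ Q m)
  end.

Fixpoint time_bound (B : nat) (q : program) : nat :=
  match q with
  | Store E1 E2 => (cost E1 + cost E2).+1
  | Seq q1 q2 => time_bound B q1 + time_bound B q2
  | If E q1 q2 => (cost E + time_bound B q1 + time_bound B q2).+1
  | While E q1 => B.+1 * (cost E + time_bound B q1).+1
  end.

Lemma wp_sound B q Q m : wp B q Q m ->
  exists t m', [/\ exec q m t m', t <= time_bound B q & Q m'].
Proof.
elim: q Q m => [E1 E2|q1 IH1 q2 IH2|E q1 IH1 q2 IH2|E q IH] Q m /=.
- move=> Qm; exists (cost E1 + cost E2).+1, (update m (eval m E1) (eval m E2)).
  by split=> //; apply: ExecStore.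
- case/IH1=> t1 [m1 [ex1 le1 /IH2[t2 [m2 [ex2 le2 Qm2]]]]].
  by exists (t1 + t2), m2; split=> //; [apply: ExecSeq ex1 ex2 | exact: leq_add].
- case: eqP => [E0 /IH2|nE0 /IH1] [t [m' [ex le_t Qm']]];
    exists (cost E + t).+1, m'; split=> //.
  + exact: ExecIfFalse.
  + by lia.
  + exact: ExecIfTrue.
  + by lia.
- set T := (cost E + time_bound B q).+1.
  elim: {1 3}B m => [|j IHj] m /=.
    case=> E0 Qm; exists (cost E).+1, m; split=> //; first exact: ExecWhileFalse.
    by rewrite mul1n /T; lia.
  case: eqP => [E0 Qm|nE0 /IH[t1 [m1 [ex1 le1 /IHj[t2 [m2 [ex2 le2 Qm2]]]]]]].
    exists (cost E).+1, m; split=> //; first exact: ExecWhileFalse.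
    by rewrite mulSn /T; lia.
  exists (cost E + t1 + t2).+1, m2; split=> //; first exact: ExecWhileTrue ex1 ex2.
  by rewrite mulSn; rewrite /T in le2 *; lia.
Qed.

Lemma time_bound_poly q : exists c d, forall B, time_bound B q <= c * B.+1 ^ d.
Proof.
have widen c d c' d' B : c * B.+1 ^ d + c' * B.+1 ^ d' <= (c + c') * B.+1 ^ (d + d').
  by rewrite mulnDl leq_add // leq_mul2l leq_pexp2l ?leq_addl ?leq_addr ?orbT.
have const_le a c d B : a + c * B.+1 ^ d <= (a + c) * B.+1 ^ d.
  by rewrite mulnDl leq_add2r leq_pmulr ?expn_gt0.
elim: q => [E1 E2|q1 [c1 [d1 IH1]] q2 [c2 [d2 IH2]]|
            E q1 [c1 [d1 IH1]] q2 [c2 [d2 IH2]]|E q [c [d IH]]] /=.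
- by exists (cost E1 + cost E2).+1, 0 => B; rewrite muln1.
- exists (c1 + c2), (d1 + d2) => B.
  exact: leq_trans (leq_add (IH1 B) (IH2 B)) (widen _ _ _ _ _).
- exists ((cost E).+1 + (c1 + c2)), (d1 + d2) => B.
  apply: leq_trans (const_le _ _ _ _).
  rewrite -addnA -addSn leq_add2l.
  exact: leq_trans (leq_add (IH1 B) (IH2 B)) (widen _ _ _ _ _).
exists ((cost E).+1 + c), d.+1 => B; rewrite expnS mulnCA leq_mul2l /=.
apply: leq_trans (const_le _ _ _ _).
by rewrite -addSn leq_add2l.
Qed.

Lemma wp_mono B q (Q Q' : memory -> Prop) m :
  (forall m', Q m' -> Q' m') -> wp B q Q m -> wp B q Q' m.
Proof.
elim: q Q Q' m => [E1 E2|q1 IH1 q2 IH2|E q1 IH1 q2 IH2|E q IH] Q Q' m QQ' /=.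
- exact: QQ'.
- by apply: IH1 => m'; apply: IH2.
- by case: ifP => _; [apply: IH1 | apply: IH2].
elim: {1 3}B m => [|j IHj] m /=; first by case=> -> /QQ'.
by case: ifP => _; [apply: IH | apply: QQ'].
Qed.

(** The decrease of [mu], which starts below [B], keeps the loop within [B]
    iterations. *)
Lemma wp_while B E q (Inv : memory -> Prop) (mu : memory -> nat) (Q : memory -> Prop) m :
  Inv m -> mu m <= B ->
  (forall m', Inv m' -> eval m' E <> 0 ->
     wp B q (fun m'' => Inv m'' /\ mu m'' < mu m') m') ->
  (forall m', Inv m' -> mu m' = 0 -> eval m' E = 0) ->
  (forall m', Inv m' -> eval m' E = 0 -> Q m') ->
  wp B (While E q) Q m.
Proof.
move=> Inv_m mu_m step stop fin /=.
elim: {1 2}B m Inv_m mu_m => [|j IHj] m Inv_m mu_m /=.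
  have E0 : eval m E = 0 by apply: stop => //; apply/eqP; rewrite -leqn0.
  by split=> //; apply: fin.
case: eqP => [E0|nE0]; first exact: fin.
apply: wp_mono (step m Inv_m nE0) => m' [Inv_m' lt_m'].
by apply: IHj => //; lia.
Qed.

Lemma wp_seq B q1 q2 Q m : wp B (Seq q1 q2) Q m = wp B q1 (wp B q2 Q) m.
Proof. by []. Qed.

Lemma wp_store B E1 E2 (Q : memory -> Prop) m a v :
  eval m E1 = a -> eval m E2 = v -> Q (update m a v) -> wp B (Store E1 E2) Q m.
Proof. by move=> <- <-. Qed.

Lemma update_same m a v : update m a v a = v.
Proof. by rewrite /update eqxx. Qed.

Lemma update_other m a v a' : a' != a -> update m a v a' = m a'.
Proof. by rewrite /update => /negPf->. Qed.

(** * A register language *)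

(** Programming the machine directly would mean computing addresses relative to
    the size of the input. Instead, memory beyond the input is organised as
    finitely many interleaved infinite arrays, indexed by registers; a scalar is
    the entry 0 of its array. *)
Inductive reg : Type :=
  rIn | rRow | rDist | rOut | rI | rJ | rW | rSame | rEnter | rOther | rInf
| rZone | rCount | rBest | rChanged | rCur | rNext | rLen.

Definition reg_code (r : reg) : nat :=
  match r with
  | rIn => 0 | rRow => 1 | rDist => 2 | rOut => 3 | rI => 4 | rJ => 5 | rW => 6
  | rSame => 7 | rEnter => 8 | rOther => 9 | rInf => 10 | rZone => 11
  | rCount => 12 | rBest => 13 | rChanged => 14 | rCur => 15 | rNext => 16
  | rLen => 17
  end.

Definition num_regs := 18.

Definition store : Type := reg -> nat -> nat.

Definition upd (s : store) r j v : store :=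
  fun r' j' => if (reg_code r' == reg_code r) && (j' == j) then v else s r' j'.
Arguments upd s r j v r' j' /.

Inductive hexpr : Type :=
| HConst of nat
| HGet of reg & hexpr
| HAdd of hexpr & hexpr
| HSub of hexpr & hexpr.

Inductive hprog : Type :=
| HSet of reg & hexpr & hexpr
| HSkip
| HSeq of hprog & hprog
| HIf of hexpr & hprog & hprog
| HWhile of hexpr & hprog.

Fixpoint heval (s : store) (E : hexpr) : nat :=
  match E with
  | HConst c => c
  | HGet r E1 => s r (heval s E1)
  | HAdd E1 E2 => heval s E1 + heval s E2
  | HSub E1 E2 => heval s E1 - heval s E2
  end.

Fixpoint hwp (B : nat) (q : hprog) (Q : store -> Prop) : store -> Prop :=
  match q with
  | HSet r E1 E2 => fun s => Q (upd s r (heval s E1) (heval s E2))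
  | HSkip => Q
  | HSeq q1 q2 => hwp B q1 (hwp B q2 Q)
  | HIf E q1 q2 => fun s => if heval s E != 0 then hwp B q1 Q s else hwp B q2 Q s
  | HWhile E q1 =>
      iter B (fun R s => if heval s E != 0 then hwp B q1 R s else Q s)
             (fun s => heval s E = 0 /\ Q s)
  end.

Lemma hwp_mono B q (Q Q' : store -> Prop) s :
  (forall s', Q s' -> Q' s') -> hwp B q Q s -> hwp B q Q' s.
Proof.
elim: q Q Q' s => [r E1 E2||q1 IH1 q2 IH2|E q1 IH1 q2 IH2|E q IH] Q Q' s QQ' /=.
- exact: QQ'.
- exact: QQ'.
- by apply: IH1 => s'; apply: IH2.
- by case: ifP => _; [apply: IH1 | apply: IH2].
elim: {1 3}B s => [|j IHj] s /=; first by case=> -> /QQ'.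
by case: ifP => _; [apply: IH | apply: QQ'].
Qed.

Lemma hwp_while B E q (Inv : store -> Prop) (mu : store -> nat) (Q : store -> Prop) s :
  Inv s -> mu s <= B ->
  (forall s', Inv s' -> heval s' E <> 0 ->
     hwp B q (fun s'' => Inv s'' /\ mu s'' < mu s') s') ->
  (forall s', Inv s' -> mu s' = 0 -> heval s' E = 0) ->
  (forall s', Inv s' -> heval s' E = 0 -> Q s') ->
  hwp B (HWhile E q) Q s.
Proof.
move=> Inv_s mu_s step stop fin /=.
elim: {1 2}B s Inv_s mu_s => [|j IHj] s Inv_s mu_s /=.
  have E0 : heval s E = 0 by apply: stop => //; apply/eqP; rewrite -leqn0.
  by split=> //; apply: fin.
case: eqP => [E0|nE0]; first exact: fin.
apply: hwp_mono (step s Inv_s nE0) => s' [Inv_s' lt_s'].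
by apply: IHj => //; lia.
Qed.

Fixpoint modifies (q : hprog) (r : reg) : bool :=
  match q with
  | HSet r' _ _ => reg_code r == reg_code r'
  | HSkip => false
  | HSeq q1 q2 | HIf _ q1 q2 => modifies q1 r || modifies q2 r
  | HWhile _ q1 => modifies q1 r
  end.

Definition agree (A : pred reg) (s s' : store) : Prop :=
  forall r j, A r -> s' r j = s r j.

(** Registers that a program does not assign keep their contents, so loop
    invariants need to mention only those that change. *)
Lemma hwp_frame B q (A : pred reg) (Q : store -> Prop) s0 s :
  (forall r, A r -> ~~ modifies q r) -> agree A s0 s -> hwp B q Q s ->
  hwp B q (fun s' => Q s' /\ agree A s0 s') s.
Proof.
elim: q Q s => [r E1 E2||q1 IH1 q2 IH2|E q1 IH1 q2 IH2|E q IH] Q s /= nmod agr.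
- move=> Qs; split=> // r' j Ar' /=.
  by rewrite (negPf (nmod r' Ar')) agr.
- by split.
- move=> wp1; have {wp1} := IH1 _ s _ agr wp1.
  have nmod1 r : A r -> ~~ modifies q1 r by move/nmod; rewrite negb_or => /andP[].
  move/(_ nmod1); apply: hwp_mono => s' [wp2 agr'].
  by apply: IH2 => // r /nmod; rewrite negb_or => /andP[].
- case: ifP => _ wp12; [apply: IH1 | apply: IH2] => // r /nmod;
    by rewrite negb_or => /andP[].
elim: {1 3}B s agr => [|j IHj] s agr /=; first by case.
case: ifP => // _ /(IH _ _ nmod agr); apply: hwp_mono => s' [wp' agr'].
exact: IHj.
Qed.

Definition hvar r := HGet r (HConst 0).
Definition hset r E := HSet r (HConst 0) E.
Arguments hvar r /.
Arguments hset r E /.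

(** Entry 0 of the input is the number of stations, the range of all counted
    loops. *)
Definition hfor i body :=
  HSeq (hset i (HConst 0))
       (HWhile (HSub (hvar rIn) (hvar i)) (HSeq body (hset i (HAdd (hvar i) (HConst 1))))).

Lemma hwp_for B i body (Inv : nat -> store -> Prop) (Q : store -> Prop) s
    (A := fun r => ~~ modifies body r && (reg_code r != reg_code i)) :
  ~~ modifies body i -> A rIn -> s rIn 0 <= B ->
  Inv 0 (upd s i 0 0) ->
  (forall j s', j < s rIn 0 -> s' i 0 = j -> agree A s s' -> Inv j s' ->
     hwp B body (fun s'' => Inv j.+1 (upd s'' i 0 j.+1)) s') ->
  (forall s', agree A s s' -> Inv (s rIn 0) s' -> Q s') ->
  hwp B (hfor i body) Q s.
Proof.
move=> nmod_i A_In le_B Inv0 step fin; set n := s rIn 0.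
have agr_upd s' v : agree A s s' -> agree A s (upd s' i 0 v).
  by move=> agr r j Ar /=; case/andP: (Ar) => _ /negPf->; apply: agr.
have upd_i s' v : upd s' i 0 v i 0 = v by rewrite /= eqxx.
change (hwp B (HWhile (HSub (hvar rIn) (hvar i))
    (HSeq body (hset i (HAdd (hvar i) (HConst 1))))) Q (upd s i 0 0)).
apply: (hwp_while (Inv := fun s' => [/\ s' i 0 <= n, agree A s s' & Inv (s' i 0) s'])
                  (mu := fun s' => n - s' i 0)).
- split; rewrite ?upd_i //; apply: agr_upd => // r j _; exact: erefl.
- by rewrite upd_i subn0.
- move=> s' [le_n agr inv'] lt_i /=; move: lt_i; rewrite /= agr // -/n => lt_i.
  have {}lt_i : s' i 0 < n by lia.
  have := step _ s' lt_i erefl agr inv'.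
  move/(hwp_frame (A := fun r => ~~ modifies body r) (s0 := s') (fun r Ar => Ar)).
  move/(_ (fun _ _ _ => erefl)); apply: hwp_mono => s'' [inv'' agr''].
  rewrite eqxx /= agr'' // addn1; split; last by lia.
  split=> //; apply: agr_upd => r j Ar.
  by rewrite agr'' ?agr //; case/andP: Ar.
- by move=> s' [le_n agr _] mu0; rewrite /= agr // -/n; lia.
move=> s' [le_n agr inv'] /=; rewrite agr // -/n => stop.
by apply: fin => //; rewrite -/n; have <- : s' i 0 = n by lia.
Qed.

(** * Compiling registers to memory *)

(** The adjacency entry of station 0 with itself, at address [n + 3], is 0 for
    every input; it serves to hold the address from which the arrays start. *)
Definition base_cell : expr := Plus (Const 3) (Cell (Const 0)).

Fixpoint repeat_add (k : nat) (E : expr) : expr :=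
  if k is k'.+1 then Plus E (repeat_add k' E) else Const 0.

Definition reg_addr (r : reg) (E : expr) : expr :=
  Plus (Cell base_cell) (Plus (Const (reg_code r)) (repeat_add num_regs E)).

Fixpoint compile_expr (E : hexpr) : expr :=
  match E with
  | HConst c => Const c
  | HGet r E1 => Cell (reg_addr r (compile_expr E1))
  | HAdd E1 E2 => Plus (compile_expr E1) (compile_expr E2)
  | HSub E1 E2 => Minus (compile_expr E1) (compile_expr E2)
  end.

Fixpoint compile (q : hprog) : program :=
  match q with
  | HSet r E1 E2 => Store (reg_addr r (compile_expr E1)) (compile_expr E2)
  | HSkip => Store (Const 0) (Cell (Const 0))
  | HSeq q1 q2 => Seq (compile q1) (compile q2)
  | HIf E q1 q2 => If (compile_expr E) (compile q1) (compile q2)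
  | HWhile E q1 => While (compile_expr E) (compile q1)
  end.

Definition represents (n b : nat) (m : memory) (s : store) : Prop :=
  [/\ m 0 = n, m (3 + n) = b, 3 + n < b
    & forall r j, m (b + (reg_code r + num_regs * j)) = s r j].

Section Compile.
Variables n b : nat.
Implicit Types (m : memory) (s : store).

Lemma eval_repeat_add m k E : eval m (repeat_add k E) = k * eval m E.
Proof. by elim: k => //= k ->. Qed.

Lemma eval_reg_addr m s r E : represents n b m s ->
  eval m (reg_addr r E) = b + (reg_code r + num_regs * eval m E).
Proof.
by case=> m0 mb _ _; rewrite /reg_addr; cbn [eval base_cell]; rewrite eval_repeat_add /= m0 mb.
Qed.

Lemma eval_compile m s E : represents n b m s -> eval m (compile_expr E) = heval s E.
Proof.
move=> rep; elim: E => [c|r E IH|E1 IH1 E2 IH2|E1 IH1 E2 IH2] //.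
- cbn [compile_expr eval]; rewrite (eval_reg_addr _ _ rep) IH.
  by case: rep.
- by rewrite /= IH1 IH2.
- by rewrite /= IH1 IH2.
Qed.

(** Interleaving makes addresses of different registers distinct whatever their
    indices are, so no bounds on array indices are ever needed. *)
Lemma represents_upd m s r j v : represents n b m s ->
  represents n b (update m (b + (reg_code r + num_regs * j)) v) (upd s r j v).
Proof.
case=> m0 mb lt_b mr; rewrite /update; split=> // [||r' j'].
- by case: eqP => // E; exfalso; lia.
- by case: eqP => // E; exfalso; lia.
have code_lt r0 : reg_code r0 < num_regs by case: r0.
rewrite /= -mr; move: (code_lt r) (code_lt r'); rewrite /num_regs => lt_r lt_r'.
by do 2!case: ifP => //; lia.
Qed.

Lemma compile_correct B q (Q : store -> Prop) m s : represents n b m s -> hwp B q Q s ->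
  wp B (compile q) (fun m' => exists2 s', represents n b m' s' & Q s') m.
Proof.
elim: q Q m s => [r E1 E2||q1 IH1 q2 IH2|E q1 IH1 q2 IH2|E q IH] Q m s rep.
- move=> Qs; cbn [compile wp]; rewrite (eval_reg_addr _ _ rep) !(eval_compile _ rep).
  by exists (upd s r (heval s E1) (heval s E2)) => //; apply: represents_upd.
- move=> Qs /=; exists s => //; case: rep => m0 mb lt_b mr.
  have updE a : update m 0 (m 0) a = m a by rewrite /update; case: eqP => // ->.
  by split=> // r j; rewrite updE.
- move=> wp12 /=; apply: wp_mono (IH1 _ _ _ rep wp12) => m' [s' rep' wp2].
  exact: IH2 rep' wp2.
- rewrite /= (eval_compile _ rep).
  by case: ifP => _; [apply: IH1 | apply: IH2].
rewrite /=; elim: {1 3}B m s rep => [|j IHj] m s rep /=.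
  by rewrite (eval_compile _ rep) => -[-> Qs]; split=> //; exists s.
rewrite (eval_compile _ rep); case: ifP => [_ wp_q|_ Qs]; last by exists s.
by apply: wp_mono (IH _ _ _ rep wp_q) => m' [s' rep' /(IHj _ _ rep')].
Qed.

End Compile.

(** * Input and output *)

Definition num_stations : expr := Cell (Const 0).
Definition scratch_cell : expr := Plus (Const 4) (Plus num_stations num_stations).

(** The diagonal adjacency entries at addresses [n + 3] and [2 * n + 4] are 0
    (for [n = 1] the latter lies just beyond the input), so these two cells
    can be used before any other free address is known. The first one receives
    [n * n + 2 * n + 5], which is beyond the input; the second one counts and is
    reset to 0. *)
Definition find_base : program :=
  Seq (While (Minus num_stations (Cell scratch_cell))
         (Seq (Store base_cell (Plus (Cell base_cell) num_stations))
              (Store scratch_cell (Plus (Cell scratch_cell) (Const 1)))))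
 (Seq (Store scratch_cell (Const 0))
      (Store base_cell
         (Plus (Cell base_cell) (Plus (Const 5) (Plus num_stations num_stations))))).

Definition base n := n * n + 2 * n + 5.

Lemma find_base_correct B n (m : memory) (Q : memory -> Prop) :
  0 < n -> n <= B -> m 0 = n -> m (3 + n) = 0 -> m (4 + (n + n)) = 0 ->
  (forall m', m' (3 + n) = base n -> (forall a, a != 3 + n -> m' a = m a) -> Q m') ->
  wp B find_base Q m.
Proof.
move=> n0 le_B m0 m3 m4 fin.
rewrite /find_base wp_seq.
apply: (wp_while (Inv := fun m' => exists i, [/\ i <= n, m' (4 + (n + n)) = i,
   m' (3 + n) = i * n
   & forall a, a != 3 + n -> a != 4 + (n + n) -> m' a = m a])
   (mu := fun m' => n - m' (4 + (n + n)))).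
- by exists 0; split.
- by rewrite m4 subn0.
- move=> m' [i [le_i m'4 m'3 m'E]]; have m'0 : m' 0 = n by rewrite m'E //; lia.
  rewrite [eval _ _]/= m'0 m'4 wp_seq => lt_i.
  apply: (@wp_store _ _ _ _ _ (3 + n) (i * n + n)); [by rewrite /= m'0 | by rewrite /= m'0 m'3 |].
  have m1_0 : update m' (3 + n) (i * n + n) 0 = n by rewrite update_other ?m'0 //; lia.
  apply: (@wp_store _ _ _ _ _ (4 + (n + n)) i.+1); first by rewrite /= m1_0.
    by rewrite /= m1_0 update_other ?m'4 ?addn1 //; lia.
  rewrite update_same; split; last by lia.
  exists i.+1; rewrite ?update_same; split=> // [||a n3 n4]; first by lia.
    by rewrite update_other ?update_same ?mulSn 1?addnC //; lia.
  by rewrite !update_other ?m'E.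
- move=> m' [i [le_i m'4 _ m'E]] mu0; have m'0 : m' 0 = n by rewrite m'E //; lia.
  by rewrite /= !m'0 mu0.
move=> m' [i [le_i m'4 m'3 m'E]]; have m'0 : m' 0 = n by rewrite m'E //; lia.
rewrite [eval _ _]/= m'0 m'4 wp_seq => ge_i; have iE : i = n by lia.
rewrite {}iE in m'3 m'4 ge_i le_i.
apply: (@wp_store _ _ _ _ _ (4 + (n + n)) 0); [by rewrite /= m'0 | by [] |].
have m1_0 : update m' (4 + (n + n)) 0 0 = n by rewrite update_other ?m'0 //; lia.
apply: (@wp_store _ _ _ _ _ (3 + n) (base n)); first by rewrite /= m1_0.
  by rewrite /= m1_0 update_other ?m'3 /base //; lia.
apply: fin => [|a n3]; first by rewrite update_same.
rewrite update_other //.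
have [->|n4] := eqVneq a (4 + (n + n)); first by rewrite update_same.
by rewrite update_other ?m'E.
Qed.

(** Once the input is in the register [rIn], it can be read without regard to the
    cells that were taken for other purposes. *)
Definition copy_input : program :=
  Seq (Store (reg_addr rI (Const 0)) (Const 0))
      (While (Minus (Cell base_cell) (compile_expr (hvar rI)))
         (Seq (Store (reg_addr rIn (compile_expr (hvar rI))) (Cell (compile_expr (hvar rI))))
              (Store (reg_addr rI (Const 0)) (compile_expr (HAdd (hvar rI) (HConst 1)))))).

Lemma copy_input_correct B n m (Q : memory -> Prop) :
  base n <= B -> m 0 = n -> m (3 + n) = base n ->
  (forall m' s, represents n (base n) m' s ->
     (forall a, a < base n -> s rIn a = m a) -> Q m') ->
  wp B copy_input Q m.
Proof.
move=> le_B m0 m3 fin; set b := base n in le_B m3 fin *.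
have rep0 : represents n b m (fun r j => m (b + (reg_code r + num_regs * j))).
  by split=> //; rewrite /b /base; lia.
rewrite /copy_input wp_seq.
apply: wp_store; [exact: eval_reg_addr rep0 | by [] |].
pose Inv m' := exists s, [/\ represents n b m' s, s rI 0 <= b,
  forall a, a < b -> m' a = m a & forall a, a < s rI 0 -> s rIn a = m a].
have low_update m' a r j v : a < b ->
    update m' (b + (reg_code r + num_regs * j)) v a = m' a.
  by move=> lt_a; rewrite update_other //; lia.
apply: (wp_while (Inv := Inv) (mu := fun m' => b - m' (b + (reg_code rI + num_regs * 0)))).
- exists (upd (fun r j => m (b + (reg_code r + num_regs * j))) rI 0 0).
  by split=> //; [apply: represents_upd | move=> a lt_a; rewrite low_update].
- by rewrite update_same subn0.
- move=> m' [s [rep le_b low sIn]].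
  have base_val : eval m' (Cell base_cell) = b by case: rep => m'0 m'b _ _; rewrite /= m'0.
  have iE : m' (b + (reg_code rI + num_regs * 0)) = s rI 0 by case: rep.
  have E_val E : eval m' (compile_expr E) = heval s E := eval_compile E rep.
  move=> test; have {test} lt_i : s rI 0 < b.
    by move: test; rewrite -[eval _ _]/(eval m' (Cell base_cell) - eval m' (compile_expr (hvar rI))) base_val E_val /=; lia.
  rewrite wp_seq; apply: wp_store; [exact: eval_reg_addr rep | exact: erefl |].
  have -> : eval m' (Cell (compile_expr (hvar rI))) = m (s rI 0).
    by rewrite -[LHS]/(m' (eval m' (compile_expr (hvar rI)))) E_val /= low.
  rewrite E_val [heval s _]/=.
  have rep1 := represents_upd rIn (s rI 0) (m (s rI 0)) rep.
  apply: wp_store; [exact: eval_reg_addr rep1 | exact: eval_compile rep1 |].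
  have rep2 := represents_upd rI 0 (s rI 0).+1 rep1.
  rewrite [heval _ _]/= addn1 update_same iE; split; last by lia.
  eexists; split; first exact: rep2.
  + by [].
  + by move=> a lt_a; rewrite !low_update ?low.
  move=> a /=; rewrite ltnS leq_eqVlt; case: eqP => [->//|_ /=]; exact: sIn.
- move=> m' [s [rep le_b low sIn]] mu0.
  have iE : m' (b + (reg_code rI + num_regs * 0)) = s rI 0 by case: rep.
  rewrite -[eval _ _]/(eval m' (Cell base_cell) - eval m' (compile_expr (hvar rI))).
  by rewrite (eval_compile _ rep) /=; case: rep => -> -> _ _; lia.
move=> m' [s [rep le_b low sIn]].
rewrite -[eval _ _]/(eval m' (Cell base_cell) - eval m' (compile_expr (hvar rI))).
rewrite (eval_compile _ rep) [heval _ _]/= => stop; apply: (fin m' s) => // a lt_a.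
by apply: sIn; move: stop; rewrite /=; case: rep => -> -> _ _; lia.
Qed.

Definition emit_output : program :=
  Seq (Store (reg_addr rI (Const 0)) (Const 0))
 (Seq (While (compile_expr (HSub (hvar rLen) (hvar rI)))
         (Seq (Store (Plus (Const 1) (compile_expr (hvar rI)))
                     (compile_expr (HGet rOut (hvar rI))))
              (Store (reg_addr rI (Const 0)) (compile_expr (HAdd (hvar rI) (HConst 1))))))
      (Store (Const 0) (compile_expr (hvar rLen)))).

(** The bound on the length keeps the result, which overwrites the input, below
    the cell [n + 3] that holds the base address. *)
Lemma emit_output_correct B n b m s (Q : memory -> Prop) :
  represents n b m s -> s rLen 0 <= n -> n <= B ->
  (forall m', output m' = mkseq (s rOut) (s rLen 0) -> Q m') ->
  wp B emit_output Q m.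
Proof.
move=> rep0 le_len le_B fin.
rewrite /emit_output wp_seq.
apply: wp_store; [exact: eval_reg_addr rep0 | by [] | rewrite wp_seq].
pose A : pred reg := fun r => reg_code r != reg_code rI.
pose Inv m' := exists s', [/\ represents n b m' s', agree A s s', s' rI 0 <= s rLen 0
  & forall a, a < s' rI 0 -> m' a.+1 = s rOut a].
apply: (wp_while (Inv := Inv)
          (mu := fun m' => s rLen 0 - m' (b + (reg_code rI + num_regs * 0)))).
- exists (upd s rI 0 0); split=> //; first exact: represents_upd.
  by move=> r j /= /negPf->.
- by rewrite update_same; lia.
- move=> m' [s' [rep agr le_i m'E]].
  rewrite (eval_compile _ rep) [heval _ _]/= agr // wp_seq => lt_i; have {}lt_i : s' rI 0 < s rLen 0 by lia.
  have iE : m' (b + (reg_code rI + num_regs * 0)) = s' rI 0 by case: rep.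
  have rep1 : represents n b (update m' (s' rI 0).+1 (s rOut (s' rI 0))) s'.
    case: rep => m'0 m'3 lt_b m'r; split=> // [|r j]; rewrite update_other ?m'r //; lia.
  apply: (@wp_store _ _ _ _ _ (s' rI 0).+1 (s rOut (s' rI 0))).
  + by rewrite -[LHS]/(1 + eval m' (compile_expr (hvar rI))) (eval_compile _ rep).
  + by rewrite (eval_compile _ rep) /= agr.
  apply: wp_store; [exact: eval_reg_addr rep1 | exact: eval_compile rep1 |].
  have rep2 := represents_upd rI 0 (s' rI 0).+1 rep1.
  rewrite [heval _ _]/= addn1 update_same iE; split; last by lia.
  eexists; split; first exact: rep2.
  + by move=> r j Ar; rewrite -agr //; move: Ar => /= /negPf->.
  + by [].
  have lt_b : 3 + n < b by case: rep.
  move=> a /= le_a; rewrite update_other; last by lia.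
  move: le_a; rewrite ltnS leq_eqVlt.
  case: eqP => [->|_ /= lt_a]; first by rewrite update_same.
  by rewrite update_other ?m'E //; lia.
- move=> m' [s' [rep agr le_i _]] mu0; rewrite (eval_compile _ rep) /= agr //.
  by case: rep mu0 => _ _ _ ->; lia.
move=> m' [s' [rep agr le_i m'E]]; rewrite (eval_compile _ rep) [heval _ _]/= agr // => stop.
apply: wp_store; [exact: erefl | exact: eval_compile rep |].
rewrite [heval _ _]/= agr //; apply: fin; rewrite /output update_same.
rewrite /mkseq (iotaDl 1 0) -map_comp; apply/eq_in_map => i.
rewrite mem_iota /= => lt_i; rewrite update_other // add1n m'E //; lia.
Qed.

(** * Bellman-Ford relaxation *)

Lemma hwp_seq B q1 q2 Q s : hwp B (HSeq q1 q2) Q s = hwp B q1 (hwp B q2 Q) s.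
Proof. by []. Qed.

Lemma hwp_set B r E1 E2 Q s :
  hwp B (HSet r E1 E2) Q s = Q (upd s r (heval s E1) (heval s E2)).
Proof. by []. Qed.

Lemma hwp_if B E q1 q2 Q s :
  hwp B (HIf E q1 q2) Q s = if heval s E != 0 then hwp B q1 Q s else hwp B q2 Q s.
Proof. by []. Qed.

Lemma hwp_set_seq B r E1 E2 q Q s :
  hwp B (HSeq (HSet r E1 E2) q) Q s = hwp B q Q (upd s r (heval s E1) (heval s E2)).
Proof. by []. Qed.

Arguments hwp : simpl never.

Definition hneq E1 E2 := HAdd (HSub E1 E2) (HSub E2 E1).

Lemma hneqE s E1 E2 : (heval s (hneq E1 E2) != 0) = (heval s E1 != heval s E2).
Proof. by rewrite /=; lia. Qed.

Definition hzone E := HGet rIn (HAdd (HConst 3) E).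

(** Non-adjacent stations count as joined by an arc of prohibitive weight [rInf],
    so that one relaxation step serves all pairs. The other weights are parameters,
    because the same relaxation computes components and distances. *)
Definition reg_weight (s : store) (i j : nat) : nat :=
  if s rIn (s rRow i + j) == 0 then s rInf 0
  else if s rIn (3 + i) == s rIn (3 + j) then s rSame 0
  else if s rZone 0 == s rIn (3 + j) then s rEnter 0
  else s rOther 0.

Definition load_weight (r : reg) : hprog :=
  HIf (HGet rIn (HAdd (HGet rRow (hvar r)) (hvar rJ)))
    (HIf (hneq (hzone (hvar r)) (hzone (hvar rJ)))
       (HIf (hneq (hvar rZone) (hzone (hvar rJ)))
          (hset rW (hvar rOther))
          (hset rW (hvar rEnter)))
       (hset rW (hvar rSame)))
    (hset rW (hvar rInf)).

Lemma load_weight_correct B r (Q : store -> Prop) s :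
  Q (upd s rW 0 (reg_weight s (s r 0) (s rJ 0))) -> hwp B (load_weight r) Q s.
Proof.
rewrite /reg_weight /load_weight hwp_if [heval _ _]/=.
case: (s rIn _ == 0) => //=; rewrite hwp_if hneqE /=.
case: (_ == s rIn (3 + s rJ 0)) => //=; rewrite hwp_if hneqE /=.
by case: (_ == s rIn (3 + s rJ 0)).
Qed.

Definition relax : hprog :=
  HSeq (load_weight rI)
    (HIf (HSub (HGet rDist (hvar rI)) (HAdd (hvar rW) (HGet rDist (hvar rJ))))
       (HSeq (HSet rDist (hvar rI) (HAdd (hvar rW) (HGet rDist (hvar rJ))))
             (hset rChanged (HConst 1)))
       HSkip).

Definition relax_all : hprog := hfor rI (hfor rJ relax).

Definition bellman_ford : hprog :=
  HSeq (hset rChanged (HConst 1))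
    (HWhile (hvar rChanged) (HSeq (hset rChanged (HConst 0)) relax_all)).

(** Costs of walks from [i], including the initial value of their end node: the
    values that relaxation can produce at [i]. *)
Inductive reaches (n : nat) (w : nat -> nat -> nat) (D0 : nat -> nat) : nat -> nat -> Prop :=
| ReachesStart i : reaches n w D0 i (D0 i)
| ReachesStep i j c : i < n -> j < n -> reaches n w D0 j c ->
    reaches n w D0 i (w i j + c).

Section BellmanFord.
Variables (s0 : store) (B : nat).
Let n := s0 rIn 0.
Let w := reg_weight s0.
Let D0 := s0 rDist.
Let kept : pred reg := fun r => ~~ modifies bellman_ford r.
Hypothesis n_le_B : n <= B.

Lemma reg_weight_agree s : agree kept s0 s -> reg_weight s =2 w.
Proof. by move=> agr i j; rewrite /w /reg_weight !agr. Qed.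

(** State of a pass that started with the values [D1] and has treated the arcs
    in [C]: as long as nothing has changed, these arcs cannot improve [D1]. *)
Definition pass_inv (D1 : nat -> nat) (C : nat -> nat -> Prop) (s : store) : Prop :=
  [/\ forall i, i < n -> reaches n w D0 i (s rDist i),
      forall i, i < n -> s rDist i <= D1 i,
      s rChanged 0 = 0 ->
        (forall i, i < n -> s rDist i = D1 i) /\
        (forall i j, i < n -> j < n -> C i j -> D1 i <= w i j + D1 j)
    & s rChanged 0 <> 0 -> exists2 i, i < n & s rDist i < D1 i].

Lemma relax_correct D1 (C : nat -> nat -> Prop) (Q : store -> Prop) s :
  agree kept s0 s -> s rI 0 < n -> s rJ 0 < n -> pass_inv D1 C s ->
  (forall s', pass_inv D1 (fun i j => C i j \/ (i = s rI 0 /\ j = s rJ 0)) s' -> Q s') ->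
  hwp B relax Q s.
Proof.
move=> agr lt_i lt_j [reach le_D1 same diff] fin; rewrite /relax hwp_seq.
apply: load_weight_correct; rewrite (reg_weight_agree agr).
rewrite hwp_if [heval _ _]/=; case: ifP => [improves|no_gain].
  rewrite hwp_seq !hwp_set; apply: fin; split=> /=.
  - move=> i lt_in; case: eqP => [->|_]; last exact: reach.
    by apply: ReachesStep => //; apply: reach.
  - move=> i lt_in; case: eqP => [->|_]; last exact: le_D1.
    by have := le_D1 _ lt_i; lia.
  - by [].
  move=> _; exists (s rI 0) => //; rewrite eqxx.
  by have := le_D1 _ lt_i; lia.
apply: fin; split=> //= /same[D1E fixC]; split=> // i j lt_in lt_jn [Cij|[-> ->]].
  exact: fixC.
by rewrite -!D1E //; lia.
Qed.

Lemma pass_inv_sub (D1 : nat -> nat) (C C' : nat -> nat -> Prop) s s' :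
  (forall i j, i < n -> j < n -> C' i j -> C i j) ->
  s' rDist =1 s rDist -> s' rChanged 0 = s rChanged 0 ->
  pass_inv D1 C s -> pass_inv D1 C' s'.
Proof.
move=> subC eqD eqC [reach le_D1 same diff]; split.
- by move=> i lt_i; rewrite eqD; apply: reach.
- by move=> i lt_i; rewrite eqD; apply: le_D1.
- rewrite eqC => /same[D1E fixC]; split=> [i lt_i|i j lt_i lt_j /subC]; first by rewrite eqD D1E.
  by move/(_ lt_i lt_j); apply: fixC.
by rewrite eqC => /diff[i lt_i lt_D]; exists i; rewrite ?eqD.
Qed.

Lemma relax_all_correct D1 (Q : store -> Prop) s :
  agree kept s0 s -> pass_inv D1 (fun _ _ => False) s ->
  (forall s', agree kept s0 s' -> pass_inv D1 (fun _ _ => True) s' -> Q s') ->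
  hwp B relax_all Q s.
Proof.
move=> agr inv fin; have nE : s rIn 0 = n by rewrite agr.
apply: (hwp_for (Inv := fun i s' => agree kept s0 s' /\ pass_inv D1 (fun i' _ => i' < i) s')) => //.
- by rewrite nE.
- split; first by move=> r j kr /=; rewrite -agr //; case: r kr.
  exact: pass_inv_sub inv.
- move=> i s' lt_i s'I _ [agr' inv']; rewrite nE in lt_i.
  apply: (hwp_for (Inv := fun j s'' =>
     [/\ agree kept s0 s'', s'' rI 0 = i & pass_inv D1 (fun i' j' => i' < i \/ (i' = i /\ j' < j)) s''])) => //.
  + by rewrite agr'.
  + split=> //; first by move=> r j kr /=; rewrite -agr' //; case: r kr.
    by apply: pass_inv_sub inv' => // i' j' _ _ [|[]].
  + move=> j s'' lt_j s''J _ [agr'' s''I inv'']; rewrite agr' // -/n in lt_j.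
    have frame := hwp_frame (A := fun r => ~~ modifies relax r) (fun r kr => kr) (fun _ _ _ => erefl).
    apply: (hwp_mono (Q := fun s3 => pass_inv D1 (fun i' j' => i' < i \/ (i' = i /\ j' < j.+1)) s3
                            /\ agree (fun r => ~~ modifies relax r) s'' s3)).
      move=> s3 [inv3 agr3]; split=> /=.
      * move=> r j' kr /=; rewrite -agr'' //; case: r kr => //= kr; exact: agr3.
      * by rewrite agr3.
      * exact: pass_inv_sub inv3.
    apply: frame; apply: relax_correct inv'' _ => //; rewrite ?s''I ?s''J //.
    move=> s3; apply: pass_inv_sub => // i' j' _ _ [lt_i'|[-> ]]; first by left; left.
    by rewrite ltnS leq_eqVlt => /predU1P[->|lt_j']; [right | left; right].
  move=> s'' _ [agr'' s''I inv'']; split.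
    by move=> r j kr /=; rewrite -agr'' //; case: r kr.
  apply: pass_inv_sub inv'' => // i' j' _ lt_j'.
  rewrite ltnS leq_eqVlt agr' // => /predU1P[->|lt_i']; [by right | by left].
move=> s' _ [agr' inv']; apply: fin => //.
by apply: pass_inv_sub inv' => // i j lt_i; rewrite nE.
Qed.

(** The sum of the values decreases in every pass but the last, which bounds the
    number of passes; the last pass certifies a fixed point of all relaxations. *)
Lemma bellman_ford_correct (Q : store -> Prop) :
  (\sum_(i < n) D0 i).+1 <= B ->
  (forall s, agree kept s0 s ->
     (forall i, i < n -> reaches n w D0 i (s rDist i)) ->
     (forall i, i < n -> s rDist i <= D0 i) ->
     (forall i j, i < n -> j < n -> s rDist i <= w i j + s rDist j) -> Q s) ->
  hwp B bellman_ford Q s0.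
Proof.
move=> le_B fin; rewrite /bellman_ford hwp_seq hwp_set [heval _ _]/= [heval _ _]/=.
apply: (hwp_while (Inv := fun s => [/\ agree kept s0 s,
   forall i, i < n -> reaches n w D0 i (s rDist i),
   forall i, i < n -> s rDist i <= D0 i
   & s rChanged 0 = 0 -> forall i j, i < n -> j < n -> s rDist i <= w i j + s rDist j])
   (mu := fun s => if s rChanged 0 == 0 then 0 else (\sum_(i < n) s rDist i).+1)).
- split=> //; first by case.
  by move=> i _; apply: ReachesStart.
- by [].
- move=> s [agr reach le_D0 _] /= changed.
  apply: (@relax_all_correct (s rDist)).
  + by move=> r j kr; rewrite -agr //; case: r kr.
  + by split.
  move=> s' agr' [reach' le_D same diff]; split.
    split=> // [i lt_i|no_change i j lt_i lt_j].
      exact: leq_trans (le_D _ lt_i) (le_D0 _ lt_i).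
    by have [DE fix_D] := same no_change; rewrite !DE //; apply: fix_D.
  case: (s rChanged 0 =P 0) changed => // _ _.
  case: eqP => // /diff[i lt_i lt_D]; rewrite ltnS.
  rewrite (bigD1 (Ordinal lt_i)) //= [ltnRHS](bigD1 (Ordinal lt_i)) //= -addSn leq_add //.
  by apply: leq_sum => j _; apply: le_D.
- by move=> s _ /=; case: eqP.
by move=> s [agr reach le_D0 fixD] /= no_change; apply: fin => //; apply: fixD.
Qed.

End BellmanFord.

(** A fixed point is below the cost of every walk, hence attains the minimum. *)
Lemma reaches_ge n w (D0 D : nat -> nat) i c :
  (forall i, i < n -> D i <= D0 i) ->
  (forall i j, i < n -> j < n -> D i <= w i j + D j) ->
  i < n -> reaches n w D0 i c -> D i <= c.
Proof.
move=> le_D0 fixD lt_i reach; elim: reach lt_i => {i c} [i|i j c lt_i lt_j _ IH _].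
  exact: le_D0.
by apply: leq_trans (fixD _ _ lt_i lt_j) _; rewrite leq_add2l IH.
Qed.

(** * The encoded network *)

Section Codes.
Variable V : finType.
Implicit Types v w : V.

Lemma station_code_lt v : station_code v < #|V|.
Proof. exact: ltn_ord. Qed.

Lemma station_code_inj : injective (@station_code V).
Proof. by move=> v w /ord_inj/enum_rank_inj. Qed.

Lemma station_code_surj i : i < #|V| -> exists v, station_code v = i.
Proof.
by move=> lt_i; exists (enum_val (Ordinal lt_i)); rewrite /station_code enum_valK.
Qed.

Lemma nth_station_code v0 v : nth v0 (enum V) (station_code v) = v.
Proof. exact: nth_enum_rank. Qed.

Lemma map_station_code : map (@station_code V) (enum V) = iota 0 #|V|.
Proof.
apply: (@eq_from_nth _ 0); rewrite size_map -cardE ?size_iota // => i lt_i.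
have [v vE] := station_code_surj lt_i.
by rewrite (nth_map v) -?cardE // nth_iota // -vE nth_station_code add0n.
Qed.

Lemma count_station_code (P : pred nat) :
  count P (iota 0 #|V|) = #|[set v : V | P (station_code v)]|.
Proof.
rewrite -map_station_code count_map -size_filter cardE.
rewrite (perm_size (_ : perm_eq _ (enum [set v | P (station_code v)]))) //.
apply: uniq_perm => [||v]; [exact: filter_uniq (enum_uniq _) | exact: enum_uniq |].
by rewrite mem_filter !mem_enum !inE andbT.
Qed.

Lemma nth_allpairs (S T : Type) (x0 : S) (y0 : T) (f : S -> T -> nat) (s : seq S) (t : seq T) i j :
  i < size s -> j < size t ->
  nth 0 [seq f a b | a <- s, b <- t] (i * size t + j) = f (nth x0 s i) (nth y0 t j).
Proof.
elim: s i => // u s IH [|i] lt_i lt_j; rewrite allpairs_cons nth_cat size_map.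
  by rewrite mul0n lt_j (nth_map y0).
by rewrite mulSn -addnA ltnNge leq_addr /= addKn IH.
Qed.

End Codes.

Section Algorithm.
Variables (V : finType) (e : rel V) (ZZ : {set {set V}}) (Z : {set V}) (k : nat).
Hypotheses (e_ptn : is_PTN e) (ZZ_part : partition ZZ [set: V]).
Hypothesis Z_disc : one_disconnected_zone e ZZ Z k.
Variables (x y : V) (B : nat).
Implicit Types (v w : V) (s : store).

Local Notation n := #|V|.
Local Notation code := (@station_code V).
Local Notation zone := (zone ZZ).
Local Notation component := (component e ZZ).
Local Notation inp := (nth 0 (input_code e ZZ x y)).

Definition zone_code A := index A (enum ZZ).

Lemma zone_code_eq v A : A \in ZZ -> (zone_code (zone v) == zone_code A) = (zone v == A).
Proof.
move=> A_ZZ; apply/eqP/eqP => [|-> //] eq_i.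
have vZ : zone v \in enum ZZ by rewrite mem_enum zone_mem.
by rewrite -[LHS](nth_index set0 vZ) -/(zone_code _) eq_i nth_index ?mem_enum.
Qed.

Lemma inp_zone v : inp (3 + code v) = zone_code (zone v).
Proof.
rewrite /input_code [3 + _]/= /= nth_cat size_map -cardE station_code_lt.
by rewrite (nth_map v) -?cardE ?station_code_lt // nth_station_code.
Qed.

Lemma inp_adj v w : inp (3 + n + (code v * n + code w)) = e v w.
Proof.
rewrite -addnA /input_code /= add0n nth_cat size_map -cardE ltnNge leq_addr /= addKn.
have sE : size (enum V) = n by rewrite -cardE.
by rewrite -{1}sE (nth_allpairs v v) ?sE ?station_code_lt // !nth_station_code.
Qed.

Lemma n_gt0 : 0 < n.
Proof. by apply/card_gt0P; exists x. Qed.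

Lemma inp_diag i : i < n -> inp (3 + n + (i * n + i)) = 0.
Proof.
by case/station_code_surj=> v <-; rewrite inp_adj; case: e_ptn => _ ->.
Qed.

Lemma inp_beyond : 1 = n -> inp 6 = 0.
Proof.
move=> n1; rewrite nth_default // /input_code !size_cat size_map size_allpairs -cardE -n1.
by [].
Qed.

Lemma adj_index_lt v w : 3 + n + (code v * n + code w) < base n.
Proof.
have : code v * n + code w < n * n.
  apply: leq_trans (_ : (code v).+1 * n <= _); last by rewrite leq_mul2r station_code_lt orbT.
  by rewrite mulSn addnC ltn_add2r station_code_lt.
by rewrite /base; lia.
Qed.

Definition ready s : Prop :=
  (forall a, a < base n -> s rIn a = inp a) /\
  (forall v, s rRow (code v) = 3 + n + code v * n).

Lemma ready_agree s s' : s' rIn =1 s rIn -> s' rRow =1 s rRow -> ready s -> ready s'.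
Proof. by move=> eqI eqR [sI sR]; split=> [a|v]; rewrite ?eqI ?eqR; [apply: sI | apply: sR]. Qed.

Lemma ready_n s : ready s -> s rIn 0 = n.
Proof. by case=> sI _; rewrite sI // /base; lia. Qed.

Lemma ready_zone s v : ready s -> s rIn (3 + code v) = zone_code (zone v).
Proof.
case=> sI _; rewrite sI ?inp_zone //.
by have := station_code_lt v; rewrite /base; lia.
Qed.

Lemma reg_weight_ready s v w : ready s -> reg_weight s (code v) (code w) =
  if ~~ e v w then s rInf 0 else if zone v == zone w then s rSame 0
  else if s rZone 0 == zone_code (zone w) then s rEnter 0 else s rOther 0.
Proof.
move=> s_ready; rewrite /reg_weight !ready_zone //.
rewrite zone_code_eq ?zone_mem //.
case: s_ready => sI sR; rewrite sR -addnA sI ?adj_index_lt // inp_adj.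
by case: (e v w).
Qed.

(** There is no multiplication, so the addresses of the rows of the adjacency
    matrix are tabulated. The first assignment restores the diagonal entry that
    was overwritten by the base address. *)
Definition init_rows : hprog :=
  HSeq (HSet rIn (HAdd (HConst 3) (hvar rIn)) (HConst 0))
 (HSeq (HSet rRow (HConst 0) (HAdd (HConst 3) (hvar rIn)))
       (hfor rI (HSeq (HSet rRow (HAdd (hvar rI) (HConst 1))
                              (HAdd (HGet rRow (hvar rI)) (hvar rIn)))
                      (HSet rDist (hvar rI) (hvar rI))))).

Hypothesis B_large : base n <= B.

Lemma n_le_B : n <= B.
Proof. by move: B_large; rewrite /base; lia. Qed.

Lemma init_rows_correct s (Q : store -> Prop) :
  (forall a, a < base n -> a != 3 + n -> s rIn a = inp a) ->
  (forall s', ready s' -> (forall v, s' rDist (code v) = code v) -> Q s') ->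
  hwp B init_rows Q s.
Proof.
move=> sI fin; rewrite /init_rows 2!hwp_set_seq /=.
have n0 := n_gt0.
have s0 : s rIn 0 = n by rewrite sI // /base; lia.
rewrite s0; set s1 := upd _ _ _ _.
have s1I a : a < base n -> s1 rIn a = inp a.
  move=> lt_a; rewrite /s1 /=; case: eqP => [->|/eqP na]; last exact: sI.
  by have := inp_diag n0; rewrite mul0n !addn0 => ->.
have s1n : s1 rIn 0 = n by rewrite s1I // /base; lia.
apply: (hwp_for (Inv := fun i s' => (forall i', i' <= i -> s' rRow i' = 3 + n + i' * n)
                                 /\ (forall i', i' < i -> s' rDist i' = i'))) => //.
- by rewrite s1n n_le_B.
- by split=> // [[|i']] //= _; rewrite mul0n addn0.
- move=> i s' lt_i s'I agr [row dist]; rewrite hwp_set_seq hwp_set /= s'I (agr rIn) // s1n.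
  split=> i' lt_i'.
    case: eqP => [->|ne]; first by rewrite row // addn1 mulSn -addnA [i * _ + _]addnC.
    by apply: row; move: ne; lia.
  by case: eqP => // ne; apply: dist; lia.
move=> s' agr [row dist]; rewrite s1n in row dist; apply: fin.
  split=> [a lt_a|v]; first by rewrite agr // s1I.
  by apply: row; apply: ltnW; apply: station_code_lt.
by move=> v; apply: dist; apply: station_code_lt.
Qed.

(** * Computing the components *)

Definition label_components : hprog :=
  HSeq (hset rSame (HConst 0))
 (HSeq (hset rEnter (hvar rIn))
 (HSeq (hset rOther (hvar rIn))
 (HSeq (hset rInf (hvar rIn))
       bellman_ford))).

Definition is_labelling s : Prop :=
  (forall v, exists2 u, s rDist (code v) = code u & component u = component v) /\
  (forall v w, component v = component w -> s rDist (code v) = s rDist (code w)).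

(** Initially every station carries its own number, which is less than the cost
    [n] of all arcs but those inside zones. These are free, so relaxation leaves
    the least number in the component. *)
Lemma label_components_correct s (Q : store -> Prop) :
  ready s -> (forall v, s rDist (code v) = code v) -> (n * n).+1 <= B ->
  (forall s', ready s' -> is_labelling s' -> Q s') ->
  hwp B label_components Q s.
Proof.
move=> s_ready distE le_B fin.
have sn := ready_n s_ready.
rewrite /label_components 4!hwp_set_seq /= sn.
set s1 := upd _ rInf _ _.
have s1_ready : ready s1 by apply: ready_agree s_ready.
have s1n : s1 rIn 0 = n by [].
have s1D v : s1 rDist (code v) = code v by apply: distE.
have weight v w : reg_weight s1 (code v) (code w)
                = if e v w && (zone v == zone w) then 0 else n.
  by rewrite reg_weight_ready //=; case: (e v w); case: eqP => //=; case: ifP.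
have [e_sym _ _] := e_ptn.
apply: bellman_ford_correct; rewrite s1n ?n_le_B //.
  apply: leq_trans le_B; rewrite ltnS.
  apply: leq_trans (_ : \sum_(i < n) n <= _); last by rewrite sum_nat_const card_ord.
  apply: leq_sum => i _; have [v <-] := station_code_surj (ltn_ord i).
  by rewrite s1D ltnW ?station_code_lt.
move=> s' agr reach le_D fixD; apply: fin; last split.
- by apply: ready_agree s1_ready => j; apply: agr.
- move=> v; have := reach _ (station_code_lt v).
  have := le_D _ (station_code_lt v); rewrite s1D => le_v.
  have : s' rDist (code v) < n := leq_ltn_trans le_v (station_code_lt v).
  move: (s' _ _) => c lt_c; move vE: (code v) => i reach_c.
  elim: reach_c v vE lt_c {le_v} => {i c} [i|i j c _ /station_code_surj[w <-] _ IH] v <-.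
    by move=> _; exists v; rewrite ?s1D.
  rewrite weight; case: ifP => [/andP[evw /eqP eq_z] lt_c|_]; last by lia.
  have [u -> uw] := IH w erefl lt_c; exists u; rewrite //= uw; symmetry.
  apply: connect_comp => //; apply: connect1.
  by rewrite /induced /= evw andbT mem_zone // eq_z mem_zone.
move=> v w /(comp_eq_connect e_sym ZZ_part)/connectP[p p_p ->].
elim: p v p_p => //= u p IH v /andP[/andP[/andP[vz uz] evu] p_p].
have zE : zone u = zone v by apply/eqP; rewrite -zoneP ?zone_mem.
rewrite -IH ?zE //.
have := fixD _ _ (station_code_lt v) (station_code_lt u).
have := fixD _ _ (station_code_lt u) (station_code_lt v).
by rewrite !weight evu e_sym evu zE eqxx /=; lia.
Qed.

(** Stations that carry their own number and canonical representatives are two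
    systems of representatives of the components of a zone. *)
Lemma card_labels s A : is_labelling s -> A \in ZZ ->
  #|[set v in A | s rDist (code v) == code v]| = n_comp (induced e A) A.
Proof.
have [e_sym _ _] := e_ptn.
case=> lab_some lab_eq A_ZZ; rewrite (n_comp_zone e ZZ_part) //.
rewrite -(card_in_imset (f := component)).
  apply: eq_card => r; rewrite inE; apply/imsetP/andP => [[v]|[rA /eqP r_r]].
    rewrite inE => /andP[vA _] ->; rewrite comp_idem // eqxx; split=> //.
    by rewrite (zoneP ZZ_part) // zone_comp // -zoneP.
  have [u labE uE] := lab_some r; exists u; last by rewrite uE r_r.
  rewrite inE (lab_eq u r uE) labE eqxx andbT.
  rewrite (zoneP ZZ_part) // -(zone_comp e ZZ_part) uE zone_comp //.
  by rewrite -zoneP.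
move=> v w; rewrite !inE => /andP[_ /eqP vE] /andP[_ /eqP wE] eq_c.
by apply: station_code_inj; rewrite -vE -wE; apply: lab_eq.
Qed.

Definition count_components : hprog :=
  HSeq (hset rBest (HConst 0))
       (hfor rI
  (HSeq (hset rCount (HConst 0))
  (HSeq (hfor rJ (HIf (hneq (HGet rDist (hvar rJ)) (hvar rJ)) HSkip
                 (HIf (hneq (hzone (hvar rJ)) (hzone (hvar rI))) HSkip
                      (hset rCount (HAdd (hvar rCount) (hvar rIn))))))
        (HIf (HSub (hvar rCount) (hvar rBest))
             (HSeq (hset rBest (hvar rCount)) (hset rZone (hzone (hvar rI))))
             HSkip)))).

(** The zone with most components is [Z] if [k > 1]. If [k = 1], any zone may be
    found, but then entering it costs as much as crossing any other border. The
    counts are kept as multiples of [n], since they are needed only as such. *)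
Lemma count_components_correct s (Q : store -> Prop) :
  ready s -> is_labelling s ->
  (forall s', ready s' -> s' rBest 0 = k * n ->
     s' rZone 0 = zone_code Z \/ k = 1 -> Q s') ->
  hwp B count_components Q s.
Proof.
move=> s_ready lab fin; have sn := ready_n s_ready.
pose is_root i j := (s rDist j == j) && (s rIn (3 + j) == s rIn (3 + i)).
pose num_below i m := count (is_root i) (iota 0 m).
have num_belowS i j : num_below i j.+1 = num_below i j + is_root i j.
  by rewrite /num_below -addn1 iotaD count_cat /= addn0.
pose num i := num_below i n.
have numE v : num (code v) = n_comp (induced e (zone v)) (zone v).
  rewrite /num /num_below count_station_code -(card_labels lab) ?zone_mem //.
  apply: eq_card => w; rewrite !inE /is_root !ready_zone // zone_code_eq ?zone_mem //.
  by rewrite andbC -zoneP ?zone_mem.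
rewrite /count_components hwp_set_seq /=; set s1 := upd _ _ _ _.
have s1n : s1 rIn 0 = n := sn.
apply: (hwp_for (Inv := fun i s' => [/\ forall i', i' < i -> n * num i' <= s' rBest 0
   & s' rBest 0 = 0 \/ exists i', [/\ i' < i, s' rBest 0 = n * num i'
                                    & s' rZone 0 = s rIn (3 + i')]])) => //.
- by rewrite s1n n_le_B.
- by split=> //; left.
- move=> i s' lt_i s'I agr [best_ge best_some].
  have s'In j : s' rIn j = s rIn j := agr rIn j isT.
  have s'D j : s' rDist j = s rDist j := agr rDist j isT.
  rewrite hwp_set_seq hwp_seq /=; set s2 := upd _ _ _ _.
  have s2n : s2 rIn 0 = n by rewrite -sn -s'In.
  apply: (hwp_for (Inv := fun j s'' => s'' rCount 0 = n * num_below i j)) => //.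
  + by rewrite s2n n_le_B.
  + by rewrite /= muln0.
  + move=> j s'' lt_j s''J agr' cnt.
    have s''In j' : s'' rIn j' = s rIn j' by rewrite -s'In; apply: agr'.
    have s''D j' : s'' rDist j' = s rDist j' by rewrite -s'D; apply: agr'.
    have s''I : s'' rI 0 = i by rewrite -s'I; apply: agr'.
    rewrite hwp_if hneqE /= s''J s''D num_belowS /is_root.
    case: eqP => _ /=; last by rewrite addn0.
    rewrite hwp_if hneqE /= s''J s''I !s''In.
    case: eqP => _ /=; last by rewrite addn0.
    by rewrite hwp_set /= cnt s''In sn mulnDr muln1.
  move=> s'' agr' cnt; rewrite s2n -/(num i) in cnt.
  have s''best : s'' rBest 0 = s' rBest 0 := agr' rBest 0 isT.
  have s''zone : s'' rZone 0 = s' rZone 0 := agr' rZone 0 isT.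
  have s''I : s'' rI 0 = i by rewrite -s'I; apply: agr'.
  have s''In j : s'' rIn j = s rIn j by rewrite -s'In; apply: agr'.
  rewrite hwp_if /= cnt s''best; rewrite subn_eq0 -ltnNge; case: ltnP => better.
    rewrite hwp_set_seq hwp_set /= cnt s''I s''In; split.
      by move=> i'; rewrite ltnS leq_eqVlt => /predU1P[-> //|/best_ge/leq_trans]; apply; apply: ltnW.
    by right; exists i.
  split=> /=; rewrite s''best ?s''zone.
    by move=> i'; rewrite ltnS leq_eqVlt => /predU1P[->|/best_ge].
  by case: best_some => [|[i' [lt_i' ? ?]]]; [left | right; exists i'; split=> //; apply: ltnW].
move=> s' agr; rewrite s1n => -[best_ge best_some].
have [Z_ZZ k0 k_comp other] := Z_disc; have [e_sym _ _] := e_ptn; have n0 := n_gt0.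
have [z zZ] : exists z, zone z = Z.
  have /set0Pn[z zZ] : Z != set0.
    by apply: contraTneq Z_ZZ => ->; case/and3P: ZZ_part.
  by exists z; apply/eqP; rewrite -zoneP.
have best_Z := best_ge _ (station_code_lt z); rewrite numE zZ k_comp in best_Z.
have [best0|[i [/station_code_surj[v <-] bestE zoneE]]] := best_some.
  by move: best_Z; rewrite best0 leqn0 muln_eq0; lia.
rewrite numE in bestE; rewrite ready_zone // in zoneE.
have s'_ready : ready s' by apply: ready_agree s_ready => j; apply: agr.
have [vZ|vZ] := eqVneq (zone v) Z.
  by apply: fin => //; [rewrite bestE vZ k_comp mulnC | left; rewrite zoneE vZ].
have v1 : n_comp (induced e (zone v)) (zone v) = 1.
  rewrite (n_comp_zone e ZZ_part) ?zone_mem //.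
  apply/eqP/cards1P; exists (component v); apply/setP=> w; rewrite !inE (zoneP ZZ_part) ?zone_mem //.
  apply/andP/eqP => [[/eqP zw /eqP <-]|->].
    by apply: (comp_connected e_sym ZZ_part other); rewrite zw.
  by rewrite zone_comp // comp_idem // !eqxx.
have k1 : k = 1.
  by move: best_Z; rewrite bestE v1 leq_pmul2l //; lia.
by apply: fin => //; [rewrite bestE v1 k1 mul1n muln1 | right].
Qed.

(** * Computing the distances to the destination *)

(** The factor [n] exceeds the number of arcs of a simple walk, so the additional
    unit per arc, which makes all weights positive, only breaks ties. *)
Definition hop v w : nat := (n * scaled_weight ZZ Z k v w).+1.

(** Larger than the cost of a simple walk: fewer than [n] arcs, each of cost at
    most [k * n + 1]. *)
Definition far : nat := n * (k * n).+1.

Definition set_weights : hprog :=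
  HSeq (hset rSame (HConst 1))
 (HSeq (hset rEnter (HAdd (hvar rIn) (HConst 1)))
 (HSeq (hset rOther (HAdd (hvar rBest) (HConst 1)))
 (HSeq (hset rInf (HConst 0))
 (HSeq (hfor rI (hset rInf (HAdd (hvar rInf) (hvar rOther))))
 (HSeq (hfor rI (HSet rDist (hvar rI) (hvar rInf)))
       (HSet rDist (HGet rIn (HConst 2)) (HConst 0))))))).

Definition has_hops s : Prop :=
  forall v w, reg_weight s (code v) (code w) = if e v w then hop v w else far.

Lemma set_weights_correct s (Q : store -> Prop) :
  ready s -> s rBest 0 = k * n -> s rZone 0 = zone_code Z \/ k = 1 ->
  (forall s', ready s' -> has_hops s' ->
     (forall v, s' rDist (code v) = if v == y then 0 else far) -> Q s') ->
  hwp B set_weights Q s.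
Proof.
move=> s_ready bestE zoneE fin; have sn := ready_n s_ready.
have [Z_ZZ k0 _ _] := Z_disc.
rewrite /set_weights 4!hwp_set_seq hwp_seq /= sn bestE !addn1.
set s1 := upd _ rInf _ _; have s1n : s1 rIn 0 = n := sn.
apply: (hwp_for (Inv := fun i s' => s' rInf 0 = i * (k * n).+1)) => //; first by rewrite s1n n_le_B.
  by move=> i s' _ _ agr /= infE; rewrite hwp_set /= infE agr //= mulSn addnC.
move=> s2 agr2; rewrite s1n => infE.
have s2In j : s2 rIn j = s rIn j := agr2 rIn j isT.
have s2n : s2 rIn 0 = n by rewrite s2In.
rewrite hwp_seq.
apply: (hwp_for (Inv := fun i s' => forall i', i' < i -> s' rDist i' = far)) => //; first by rewrite s2n n_le_B.
  move=> i s' _ s'I agr distE i'; rewrite /= s'I (agr rInf) // infE.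
  by case: eqP => // ne lt_i'; apply: distE; lia.
move=> s3 agr3; rewrite s2n => distE.
have s3In j : s3 rIn j = s rIn j by rewrite -s2In; apply: agr3.
rewrite hwp_set /=; set s4 := upd _ _ _ _.
have s4_ready : ready s4.
  apply: ready_agree s_ready => j; first exact: s3In.
  by rewrite -[LHS]/(s3 rRow j) (agr3 rRow) // (agr2 rRow).
apply: fin => // [v w|v].
  rewrite reg_weight_ready // -[s4 rInf 0]/(s3 rInf 0) (agr3 rInf) // infE.
  case: (e v w) => //=.
  rewrite -[s4 rSame 0]/(s3 rSame 0) (agr3 rSame) // (agr2 rSame) // -[s1 rSame 0]/1.
  rewrite -[s4 rEnter 0]/(s3 rEnter 0) (agr3 rEnter) // (agr2 rEnter) // -[s1 rEnter 0]/(n.+1).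
  rewrite -[s4 rOther 0]/(s3 rOther 0) (agr3 rOther) // (agr2 rOther) // -[s1 rOther 0]/((k * n).+1).
  rewrite -[s4 rZone 0]/(s3 rZone 0) (agr3 rZone) // (agr2 rZone) // -[s1 rZone 0]/(s rZone 0).
  rewrite /hop /scaled_weight !(zoneP ZZ_part) //.
  case: (eqVneq (zone v) (zone w)) => [->|vw]; first by rewrite andbN muln0.
  case: zoneE => [->|k1]; last by rewrite k1 mul1n !if_same muln1.
  rewrite eq_sym zone_code_eq //.
  by case: (eqVneq (zone w) Z) vw => [-> -> |_ _] /=; rewrite ?muln1 // mulnC.
rewrite -[s4 _ _]/(if code v == s3 rIn 2 then 0 else s3 rDist (code v)) s3In.
case: s_ready => sI _; rewrite sI; last by rewrite /base; lia.
rewrite -[inp 2]/(code y) (inj_eq (@station_code_inj V)); case: eqP => // _.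
exact: distE (station_code_lt v).
Qed.

(** The second part, which follows from minimality, is what the reconstruction of a
    walk from the distances needs. *)
Definition is_distance s : Prop :=
  (forall v p, path e v p -> last v p = y -> s rDist (code v) <= walk_cost hop v p) /\
  (forall v, v != y -> exists2 w, e v w & s rDist (code v) = hop v w + s rDist (code w)).

Lemma k_le_n : k <= n.
Proof.
have [_ _ <- _] := Z_disc; exact: max_card.
Qed.

Lemma hop_le v w : hop v w <= (k * n).+1.
Proof.
have [_ k0 _ _] := Z_disc.
rewrite /hop ltnS mulnC leq_mul2r /scaled_weight; apply/orP; right.
by case: ifP => // _; case: ifP.
Qed.

(** Hence the arcs of weight [far] that stand for missing edges, and the initial
    value [far] at stations other than [y], never determine a distance. *)
Lemma ex_near_walk v : exists p, [/\ path e v p, last v p = y & walk_cost hop v p < far].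
Proof.
have [_ _ conn] := e_ptn; have /connectP[p p_p ->] := conn v y.
case/shortenP: p_p => q p_q u_q _; exists q; split=> //.
have size_q : size q < n by rewrite -[_.+1]/(size (v :: q)) -(card_uniqP u_q) max_card.
apply: leq_ltn_trans (_ : size q * (k * n).+1 < _); last by rewrite ltn_mul2r size_q.
elim: (q) (v) => //= w q' IH v'; rewrite mulSn leq_add //; exact: hop_le.
Qed.

Hypothesis B_far : (n * far).+1 <= B.

Lemma distance_correct s (Q : store -> Prop) :
  ready s -> has_hops s -> (forall v, s rDist (code v) = if v == y then 0 else far) ->
  (forall s', ready s' -> has_hops s' -> is_distance s' ->
     (forall v, s' rDist (code v) <= far) -> Q s') ->
  hwp B bellman_ford Q s.
Proof.
move=> s_ready hops distE fin; have sn := ready_n s_ready.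
apply: bellman_ford_correct; rewrite sn ?n_le_B //.
  apply: leq_trans B_far; rewrite ltnS.
  apply: leq_trans (_ : \sum_(i < n) far <= _); last by rewrite sum_nat_const card_ord.
  by apply: leq_sum => i _; have [v <-] := station_code_surj (ltn_ord i); rewrite distE; case: ifP.
move=> s' agr reach le_D fixD.
have dist_le v p : path e v p -> last v p = y -> s' rDist (code v) <= walk_cost hop v p.
  elim: p v => [|w p IH] v /=.
    by move=> _ ->; apply: leq_trans (le_D _ (station_code_lt y)) _; rewrite distE eqxx.
  case/andP=> evw /IH {}IH /IH le_w.
  apply: leq_trans (fixD _ _ (station_code_lt v) (station_code_lt w)) _.
  by rewrite hops evw leq_add2l.
apply: fin.
- by apply: ready_agree s_ready => j; apply: agr.
- by move=> v w; rewrite (reg_weight_agree agr) hops.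
- split=> // v vy.
  have [p [p_p l_p near]] := ex_near_walk v.
  have {near} lt_far := leq_ltn_trans (dist_le v p p_p l_p) near.
  have := reach _ (station_code_lt v); move cE: (s' _ _) => c reach_c.
  move iE: (code v) reach_c => i reach_c.
  case: reach_c iE cE => {i c} [i <- cE|i j c _ /station_code_surj[w <-] reach_w <- cE].
    by rewrite cE distE (negPf vy) ltnn in lt_far.
  move: cE; rewrite hops; case evw: (e v w) => cE; last by rewrite cE in lt_far; lia.
  have le_c : s' rDist (code w) <= c.
    by apply: reaches_ge reach_w => //; apply: station_code_lt.
  have := fixD _ _ (station_code_lt v) (station_code_lt w).
  rewrite hops evw cE leq_add2l => ge_c.
  by exists w => //; apply/eqP; rewrite eqn_add2l eqn_leq ge_c.
by move=> v; apply: leq_trans (le_D _ (station_code_lt v)) _; rewrite distE; case: ifP.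
Qed.

(** * Following the distances *)

Definition trace_walk : hprog :=
  HSeq (hset rCur (HGet rIn (HConst 1)))
 (HSeq (hset rLen (HConst 0))
 (HSeq (HWhile (HGet rDist (hvar rCur))
   (HSeq (HSet rOut (hvar rLen) (hvar rCur))
   (HSeq (hset rLen (HAdd (hvar rLen) (HConst 1)))
   (HSeq (hfor rJ
      (HSeq (load_weight rCur)
            (HIf (hneq (HGet rDist (hvar rCur)) (HAdd (hvar rW) (HGet rDist (hvar rJ))))
                 HSkip
                 (hset rNext (hvar rJ)))))
         (hset rCur (hvar rNext))))))
 (HSeq (HSet rOut (hvar rLen) (hvar rCur))
       (hset rLen (HAdd (hvar rLen) (HConst 1)))))).

(** Distances decrease along the walk, so it does not visit a station twice, and
    its length stays within the bound that the output needs. *)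
Lemma trace_walk_correct s (Q : store -> Prop) :
  ready s -> has_hops s -> is_distance s -> s rDist (code x) <= B ->
  (forall s' p, path e x p -> last x p = y ->
     walk_cost hop x p = s rDist (code x) ->
     size (x :: p) <= n -> s' rLen 0 = size (x :: p) ->
     mkseq (s' rOut) (s' rLen 0) = map code (x :: p) -> Q s') ->
  hwp B trace_walk Q s.
Proof.
move=> s_ready hops [dist_le dist_step] le_B fin; have sn := ready_n s_ready.
have far_gt0 : 0 < far by rewrite muln_gt0 n_gt0.
pose D v := s rDist (code v).
have Dy : D y = 0 by apply/eqP; rewrite -leqn0; apply: (dist_le y [::]).
have D0 v : D v = 0 -> v = y.
  move=> Dv; apply/eqP; apply/negPn/negP => /dist_step[w _].
  by rewrite -/(D v) Dv.
rewrite /trace_walk 2!hwp_set_seq hwp_seq /=.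
have -> : s rIn 1 = code x by case: s_ready => -> //; rewrite /base; lia.
set s1 := upd _ rLen _ _.
pose kept : pred reg := fun r => ~~ modifies trace_walk r.
pose Inv s' := agree kept s s' /\ exists p, let u := last x p in
  [/\ s' rCur 0 = code u, s' rLen 0 = size p, path e x p,
      walk_cost hop x p + D u = D x & path (fun v w => D w < D v) x p] /\
  forall i, i < size p -> s' rOut i = code (nth x (x :: p) i).
apply: (hwp_while (Inv := Inv) (mu := fun s' => s rDist (s' rCur 0))).
- split; first by case.
  by exists [::].
- exact: le_B.
- move=> s' [agr [p [[curE lenE p_p costE dec] outE]]].
  rewrite [heval _ _]/= (agr rDist) // curE -/(D _) => D_nz.
  set u := last x p in curE costE D_nz *.
  have uy : u != y by apply/eqP=> uy; rewrite uy Dy in D_nz.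
  rewrite 2!hwp_set_seq hwp_seq /= lenE curE addn1; set s2 := upd _ rLen _ _.
  have agr2 : agree kept s s2 by move=> r j kr; rewrite -agr //; case: r kr.
  have s2n : s2 rIn 0 = n by rewrite (agr2 rIn).
  have weight v w s3 : (forall r j, kept r -> s3 r j = s r j) ->
      reg_weight s3 (code v) (code w) = if e v w then hop v w else far.
    by move=> eqs; rewrite -hops /reg_weight !eqs.
  pose good j := exists w, [/\ j = code w, e u w & D u = hop u w + D w].
  have goodE s3 w : (forall r j, kept r -> s3 r j = s r j) ->
      (D u == reg_weight s3 (code u) (code w) + D w) = (e u w && (D u == hop u w + D w)).
    move=> eqs; rewrite weight //; case: (e u w) => //=.
    have [q [p_q l_q near]] := ex_near_walk u.
    have := leq_ltn_trans (dist_le u q p_q l_q) near; rewrite -/(D u) => lt_far.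
    by apply/eqP; lia.
  apply: (hwp_for (Inv := fun j s' => (exists2 j', j' < j & good j') -> good (s' rNext 0))) => //.
  + by rewrite s2n n_le_B.
  + by case.
  + move=> j s3 lt_j s3J agr3 IH; rewrite s2n in lt_j.
    have eqs3 r i : kept r -> s3 r i = s r i.
      by move=> kr; rewrite -agr2 // agr3 //; case: r kr.
    have [w jE] := station_code_surj lt_j.
    have s3cur : s3 rCur 0 = code u by rewrite (agr3 rCur).
    rewrite hwp_seq; apply: load_weight_correct; rewrite hwp_if hneqE /= s3cur s3J !(eqs3 rDist) //.
    rewrite -jE -/(D u) -/(D w) goodE //.
    case: andP => [[euw /eqP Du]|not_good] /=.
      by rewrite hwp_set /= s3J => _; exists w.
    move=> [j' lt_j' good_j']; apply: IH.
    move: lt_j'; rewrite ltnS leq_eqVlt => /predU1P[j'E|lt_j'']; last first.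
      by exists j'; rewrite -?jE.
    case: not_good; case: good_j' => w'; rewrite j'E => -[/station_code_inj <- euw' ->].
    by rewrite eqxx.
  move=> s3 agr3; rewrite s2n; case=> [|w [nextE euw Du]].
    have [w euw Du] := dist_step u uy; exists (code w); first exact: station_code_lt.
    by exists w.
  have eqs3 r i : kept r -> s3 r i = s r i.
    by move=> kr; rewrite -agr2 // agr3 //; case: r kr.
  rewrite hwp_set /= nextE -/(D w) -/(D u) Du; split; last by rewrite /hop; lia.
  split; first by move=> r j kr; rewrite -eqs3 //; case: r kr.
  exists (rcons p w); rewrite last_rcons; split.
    split=> //=.
    * by rewrite (agr3 rLen) //= size_rcons.
    * by rewrite rcons_path p_p.
    * by rewrite -cats1 walk_cost_cat /= addn0 -addnA -Du.
    * by rewrite rcons_path dec -/u Du /hop; lia.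
  move=> i; rewrite size_rcons ltnS => le_i /=; rewrite (agr3 rOut) //.
  rewrite -[s2 rOut i]/(if i == size p then code u else s' rOut i) -rcons_cons nth_rcons /= ltnS le_i.
  case: eqP => [->|ne_i]; first by rewrite -last_nth.
  by rewrite outE // ltn_neqAle le_i andbT; apply/eqP.
- by move=> s' [agr _] /= ; rewrite (agr rDist).
move=> s' [agr [p [[curE lenE p_p costE dec] outE]]] /=.
rewrite (agr rDist) // curE -/(D _) => /D0 l_p.
rewrite hwp_set_seq hwp_set /= lenE curE addn1.
apply: (fin _ p) => //.
- by rewrite -/(D x) -costE l_p Dy addn0.
- have u_p : uniq (x :: p).
    apply: (sorted_uniq (leT := fun v w => D w < D v)) => // [v1 v2 v3 /= lt1 lt2|v].
      exact: ltn_trans lt2 lt1.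
    by rewrite /= ltnn.
  by rewrite -(card_uniqP u_p) max_card.
rewrite /= -[RHS]/(map code (x :: p)).
apply: (@eq_from_nth _ 0); rewrite size_mkseq ?size_map // => i lt_i.
rewrite nth_mkseq // (nth_map x) //=; case: eqP => [->|/eqP ne_i]; first by rewrite -last_nth.
by apply: outE; move: lt_i; rewrite ltnS leq_eqVlt (negPf ne_i).
Qed.


(** * The algorithm *)

Definition find_walk : hprog :=
  HSeq init_rows
 (HSeq label_components
 (HSeq count_components
 (HSeq set_weights
 (HSeq bellman_ford
       trace_walk)))).

Definition algorithm : program :=
  Seq find_base (Seq copy_input (Seq (compile find_walk) emit_output)).

Lemma walk_cost_hop v p :
  walk_cost hop v p = n * walk_cost (scaled_weight ZZ Z k) v p + size p.
Proof.
elim: p v => [|w p IH] v /=; first by rewrite muln0.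
by rewrite IH mulnDr /hop addnS addSn addnA.
Qed.

(** A competitor may be assumed simple; its number of arcs is then less than
    [n], too small to outweigh one unit of the scaled weight. *)
Lemma min_hop_min_weight p : path e x p -> last x p = y ->
  (forall p', path e x p' -> last x p' = y -> walk_cost hop x p <= walk_cost hop x p') ->
  shortest_path e (modified_weight ZZ Z k) x y (x :: p).
Proof.
move=> p_p l_p min_p; have [Z_ZZ k0 _ _] := Z_disc.
apply/shortest_pathP => //; exists p; split=> // p' p_p' l_p'.
have [q [p_q l_q u_q le_q]] := simple_walk (scaled_weight ZZ Z k) p_p'.
apply: leq_trans le_q.
have size_q : size q < n by rewrite -[_.+1]/(size (x :: q)) -(card_uniqP u_q) max_card.
have := min_p q p_q (etrans l_q l_p'); rewrite !walk_cost_hop => le_pq.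
rewrite -ltnS -(ltn_pmul2l n_gt0) mulnS addnC.
apply: leq_ltn_trans (leq_trans (leq_addr _ _) le_pq) _.
by rewrite ltn_add2l.
Qed.

Lemma find_walk_correct s (Q : store -> Prop) :
  (forall a, a < base n -> a != 3 + n -> s rIn a = inp a) ->
  (forall s' p, shortest_path e (modified_weight ZZ Z k) x y (x :: p) ->
     s' rLen 0 <= n -> mkseq (s' rOut) (s' rLen 0) = map code (x :: p) -> Q s') ->
  hwp B find_walk Q s.
Proof.
move=> sI fin; rewrite /find_walk hwp_seq.
have n0 := n_gt0.
have far_gt : n * n <= n * far by rewrite leq_mul2l leq_pmulr ?orbT.
apply: init_rows_correct => // s1 ready1 dist1; rewrite hwp_seq.
apply: label_components_correct => //; first by apply: leq_trans B_far; rewrite ltnS.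
move=> s2 ready2 lab2; rewrite hwp_seq.
apply: count_components_correct => // s3 ready3 best3 zone3; rewrite hwp_seq.
apply: set_weights_correct best3 zone3 _ => // s4 ready4 hops4 dist4; rewrite hwp_seq.
apply: distance_correct dist4 _ => // s5 ready5 hops5 dist5 le_far.
apply: trace_walk_correct => //.
  apply: leq_trans (le_far x) (leq_trans _ (ltnW B_far)).
  by rewrite leq_pmull.
move=> s6 p p_p l_p costE size_p lenE outE.
apply: (fin s6 p) => //; last by rewrite lenE.
apply: min_hop_min_weight => // p' p_p' l_p'; rewrite costE.
by case: dist5 => dist_le _; apply: dist_le.
Qed.

Lemma algorithm_correct :
  wp B algorithm (fun m => exists W, output m = map code W /\
     shortest_path e (modified_weight ZZ Z k) x y W)
   (initial_memory (input_code e ZZ x y)).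
Proof.
have n0 := n_gt0; rewrite /initial_memory /algorithm wp_seq.
apply: (@find_base_correct _ n) => //; first exact: n_le_B.
- by have := inp_diag n0; rewrite mul0n !addn0.
- have [n2|n1] := ltnP 1 n.
    have -> : 4 + (n + n) = 3 + n + (1 * n + 1) by lia.
    exact: inp_diag.
  by have n1E : 1 = n by [lia]; rewrite -n1E; apply: inp_beyond.
move=> m1 base1 low1; rewrite wp_seq.
apply: (@copy_input_correct _ n) => //; first by rewrite low1 //; lia.
move=> m2 s2 rep2 in2; rewrite wp_seq.
have in2' a : a < base n -> a != 3 + n -> s2 rIn a = inp a.
  by move=> lt_a ne_a; rewrite in2 // low1.
apply: wp_mono (compile_correct (B := B) rep2 (find_walk_correct (Q := fun s =>
  exists p, [/\ shortest_path e (modified_weight ZZ Z k) x y (x :: p), s rLen 0 <= n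
    & mkseq (s rOut) (s rLen 0) = map code (x :: p)]) in2' _)); last first.
  by move=> s' p ? ? ?; exists p.
move=> m3 [s3 rep3 [p [short_p le_len outE]]].
apply: (emit_output_correct rep3) => //; first exact: n_le_B.
by move=> m' ->; exists (x :: p).
Qed.

End Algorithm.

Local Open Scope ring_scope.

Theorem lemma47 :
  exists (algorithm : program) (c d : nat),
  forall (V : finType) (e : rel V) (ZZ : {set {set V}}) (Z : {set V}) (k : nat),
  is_PTN e ->
  partition ZZ [set: V] ->
  one_disconnected_zone e ZZ Z k ->
  forall x y : V,
  (exists (W : seq V) (t : nat) (m : memory),
     [/\ exec algorithm (initial_memory (input_code e ZZ x y)) t m,
         (t <= c * #|V| ^ d)%N,
         output m = [seq station_code v | v <- W]
       & shortest_path e (modified_weight ZZ Z k) x y W])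
  /\
  (forall (R : realType) (P : nat -> R) (p : seq V -> R),
   nonnegative_price P ->
   increasing_price P ->
   single_counting_tariff e p ZZ P ->
   forall W : seq V,
   shortest_path e (modified_weight ZZ Z k) x y W ->
   [/\ cheapest_path e p x y W,
       cheapest_standard_ticket e p x y (standard_ticket W)
     & no_benefit_from_splitting P ->
       cheapest_ticket e p x y (standard_ticket W)]).
Proof.
have [c [d time_le]] := time_bound_poly algorithm.
exists algorithm, (c * 9 ^ d)%N, (4 * d)%N => V e ZZ Z k e_ptn ZZ_part Z_disc x y.
split; last first.
  move=> R P p _ P_incr p_zones W; apply: shortest_path_cheapest P_incr p_zones => //.
  by case: e_ptn.
set n := #|V|; have n_gt0 : (0 < n)%N by apply/card_gt0P; exists x.
(* The largest loop bound is that of the distance computation: the initial values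
   have sum less than [n * far], which is at most [n ^ 4 + n ^ 2]. *)
pose B := (8 * n ^ 4)%N.
have n2_gt : (n <= n * n)%N by rewrite leq_pmull.
have n4E : (n ^ 4 = (n * n) * (n * n))%N by rewrite -[4%N]/(2 + 2)%N expnD.
have n4_ge : (n * n <= n ^ 4)%N by rewrite n4E leq_pmull // muln_gt0 n_gt0.
have B_base : (base n <= B)%N by rewrite /base /B; lia.
have B_far : ((n * far V k).+1 <= B)%N.
  have far_le : (n * far V k <= (n * n) * (n * n).+1)%N.
    rewrite /far mulnA leq_mul2l ltnS leq_mul2r.
    by rewrite (k_le_n Z_disc) !orbT.
  by move: far_le; rewrite mulnS -n4E /B; lia.
have [t [m [ex_t le_t [W [outE short_W]]]]] :=
  wp_sound (algorithm_correct e_ptn ZZ_part Z_disc x y B_base B_far).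
exists W, t, m; split=> //.
apply: leq_trans le_t (leq_trans (time_le B) _).
rewrite expnM -mulnA -expnMn leq_mul2l.
have B_le : (B.+1 <= 9 * n ^ 4)%N by rewrite /B; lia.
apply/orP; right; have [->|d_gt0] := posnP d; first by rewrite !expn0.
by rewrite leq_exp2r.
Qed.
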